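(* Let $V$ be a strongly $A$-graded Möbius vertex algebra, $W_1,W_2$ strongly $\tilde A$-graded generalized $V$-modules, $z\in\mathbb C^\times$, and let $\lambda\in(W_1\otimes W_2)^*$ satisfy the $P(z)$-compatibility condition. Then for all $u,v\in V$, $$x_0^{-1}\delta\Big(\frac{x_1-x_2}{x_0}\Big)Y'_{P(z)}(u,x_1)Y'_{P(z)}(v,x_2)\lambda-x_0^{-1}\delta\Big(\frac{x_2-x_1}{-x_0}\Big)Y'_{P(z)}(v,x_2)Y'_{P(z)}(u,x_1)\lambda=x_2^{-1}\delta\Big(\frac{x_1-x_0}{x_2}\Big)Y'_{P(z)}(Y(u,x_0)v,x_2)\lambda .$$
   Context: Formal calculus: $x,x_0,x_1,x_2$ commuting independent formal variables; $\delta(x)=\sum_{n\in\mathbb Z}x^n$; binomial expansions in nonnegative integral powers of the second summand (complex numbers may occur in place of variables); $\mathrm{Res}_x$ takes the coefficient of $x^{-1}$. Möbius vertex algebras, generalized modules $W=\coprod_{n\in\mathbb C}W_{[n]}$ with $\mathfrak{sl}(2)$-actions $L(-1),L(0),L(1)$, and strong gradedness (second gradings by abelian groups $A\subset\tilde A$ compatible with weight gradings, finite-dimensional doubly homogeneous spaces, appropriate truncation from below, $v_lW^{(\beta)}\subset W^{(\alpha+\beta)}$ for $v\in V^{(\alpha)}$, $L(j)$ grading-preserving) are as usual; strong gradedness makes $L(1)$ locally nilpotent on $V$. Opposite operators: $Y^o_W(v,x)=Y_W(e^{xL(1)}(-x^{-2})^{L(0)}v,x^{-1})$, with $(-x^{-2})^{L(0)}v=(-1)^nx^{-2n}v$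 for $v\in V_{(n)}$. For $\lambda\in(W_1\otimes W_2)^*$ and $v\in V$, $Y'_{P(z)}(v,x)\lambda\in(W_1\otimes W_2)^*[[x,x^{-1}]]$ is defined by $$(Y'_{P(z)}(v,x)\lambda)(w_{(1)}\otimes w_{(2)})=\lambda(w_{(1)}\otimes Y_2^o(v,x)w_{(2)})+\mathrm{Res}_{x_0}\,z^{-1}\delta\Big(\frac{x^{-1}-x_0}{z}\Big)\lambda\big(Y_1(e^{xL(1)}(-x^{-2})^{L(0)}v,x_0)w_{(1)}\otimes w_{(2)}\big).$$ $P(z)$-compatibility condition on $\lambda$: (a) for every $v\in V$, $Y'_{P(z)}(v,x)\lambda$ involves only finitely many negative powers of $x$; (b) for every $v\in V$, $w_{(1)}\in W_1$, $w_{(2)}\in W_2$, $$x_0^{-1}\delta\Big(\frac{x_1^{-1}-z}{x_0}\Big)(Y'_{P(z)}(v,x_1)\lambda)(w_{(1)}\otimes w_{(2)})=z^{-1}\delta\Big(\frac{x_1^{-1}-x_0}{z}\Big)\lambda\big(Y_1(e^{x_1L(1)}(-x_1^{-2})^{L(0)}v,x_0)w_{(1)}\otimes w_{(2)}\big)+x_0^{-1}\delta\Big(\frac{z-x_1^{-1}}{-x_0}\Big)\lambda\big(w_{(1)}\otimes Y_2^o(v,x_1)w_{(2)}\big).$$ *)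

(* Defs.v *)
(* Formal calculus is implemented literally: a formal series in the three
   commuting variables x0, x1, x2 with coefficients in X is a function
   E -> X, where e = ((a, b), c) : E is the exponent of x0^a x1^b x2^c.
   Series in fewer variables are embedded with exponent 0 in the unused
   slots.  Infinite sums that occur in products of series are taken with the
   finitely supported sum \sum_(i \in A) of mathcomp-analysis (fsbigop); in
   every product occurring below the sum is in fact finite. *)
From HB Require Import structures.
From mathcomp Require Import all_boot all_order all_algebra.
From mathcomp Require Import complex.
From mathcomp Require Import classical_sets fsbigop reals.

Set Implicit Arguments.
Unset Strict Implicit.
Unset Printing Implicit Defensive.
Import Order.TTheory GRing.Theory Num.Theory.
Local Open Scope ring_scope.

Definition E := (int * int * int)%type.
Definition eadd (e f : E) : E := ((e.1.1 + f.1.1, e.1.2 + f.1.2), e.2 + f.2).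
Definition escale (n : int) (e : E) : E := ((n * e.1.1, n * e.1.2), n * e.2).
Definition enil : E := ((0, 0), 0).
Definition ex0 : E := ((1, 0), 0).
Definition ex1 : E := ((0, 1), 0).
Definition ex2 : E := ((0, 0), 1).
Definition ex1inv : E := ((0, -1), 0).

Definition ser (X : Type) := E -> X.

Definition smul (C : fieldType) (X : lmodType C) (S : ser C) (F : ser X)
  : ser X := fun e =>
  \sum_(p \in [set p : E * E | eadd p.1 p.2 = e]) (S p.1 *: F p.2).

Definition smulC (C : fieldType) (S F : ser C) : ser C := @smul C C^o S F.

Definition gbinom (C : fieldType) (n : int) (k : nat) : C :=
  (\prod_(i < k) (n%:~R - i%:R)) / (k`!)%:R.

(* a "term" (c, e) stands for the signed monomial c x^e (c a nonzero number,
   e possibly zero: then the term is the constant c) *)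
Definition term (C : fieldType) := (C * E)%type.

(* deltaser P t1 t2 D  ==  P^{-1} delta((t1 + t2)/D)
     = sum_{n in Z} P^{-1} (t1 + t2)^n D^{-n},
   with (t1 + t2)^n = sum_{k >= 0} binom(n,k) t1^{n-k} t2^k
   (binomial expansion in nonnegative powers of the second summand). *)
Definition deltaser (C : fieldType) (P t1 t2 D : term C) : ser C := fun e =>
  \sum_(nk \in [set nk : int * nat |
         eadd (escale (-1) P.2)
           (eadd (escale (nk.1 - nk.2%:Z) t1.2)
              (eadd (escale nk.2%:Z t2.2) (escale (- nk.1) D.2))) = e])
    (P.1 ^ (-1) * gbinom C nk.1 nk.2 * t1.1 ^ (nk.1 - nk.2%:Z)
       * t2.1 ^+ nk.2 * D.1 ^ (- nk.1)).

Definition delta_12_0 (C : fieldType) : ser C :=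
  deltaser (1, ex0) (1, ex1) (-1, ex2) (1, ex0).
Definition delta_21_m0 (C : fieldType) : ser C :=
  deltaser (1, ex0) (1, ex2) (-1, ex1) (-1, ex0).
Definition delta_10_2 (C : fieldType) : ser C :=
  deltaser (1, ex2) (1, ex1) (-1, ex0) (1, ex2).
Definition delta_1z_0 (C : fieldType) (z : C) : ser C :=
  deltaser (1, ex0) (1, ex1inv) (-z, enil) (1, ex0).
Definition delta_10_z (C : fieldType) (z : C) : ser C :=
  deltaser (z, enil) (1, ex1inv) (-1, ex0) (z, enil).
Definition delta_z1_m0 (C : fieldType) (z : C) : ser C :=
  deltaser (1, ex0) (z, enil) (-1, ex1inv) (-1, ex0).

Definition is_lin (C : fieldType) (X Y : lmodType C) (f : X -> Y) :=
  forall (a : C) (x y : X), f (a *: x + y) = a *: f x + f y.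

(* pi is the family of projections of a direct sum decomposition
   X = coprod_{i in I} X_i   (X_i = image of pi i) *)
Definition decomposition (C : fieldType) (I : eqType) (X : lmodType C)
  (pi : I -> X -> X) :=
  [/\ (forall i, is_lin (pi i)),
      (forall i j x, pi i (pi j x) = if i == j then pi i x else 0) &
      (forall x, exists s : seq I,
         [/\ uniq s, (forall i, i \notin s -> pi i x = 0) &
             x = \sum_(i <- s) pi i x])].

Definition findim (C : fieldType) (X : lmodType C) (S : set X) :=
  exists s : seq X, forall x, S x ->
    exists c : nat -> C, x = \sum_(i < size s) c i *: s`_i.

(* Vertex operators.  Y v n == the mode v_n, Y(v,x) = sum_n v_n x^{-n-1}. *)
(* L j (j = -1, 0, 1) == the operators L(j)                             *)

Definition jacobi (C : fieldType) (V W : lmodType C)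
  (YV : V -> int -> V -> V) (YW : V -> int -> W -> W) :=
  forall (u v : V) (w : W) (e : E),
    smul (delta_12_0 C)
      (fun e => if e.1.1 == 0 then YW u (- e.1.2 - 1) (YW v (- e.2 - 1) w)
                else 0) e
  - smul (delta_21_m0 C)
      (fun e => if e.1.1 == 0 then YW v (- e.2 - 1) (YW u (- e.1.2 - 1) w)
                else 0) e
  = smul (delta_10_2 C)
      (fun e => if e.1.2 == 0 then YW (YV u (- e.1.1 - 1) v) (- e.2 - 1) w
                else 0) e.

Definition mobius_action (C : fieldType) (V W : lmodType C)
  (YV : V -> int -> V -> V) (one : V) (LV : int -> V -> V)
  (YW : V -> int -> W -> W) (LW : int -> W -> W) :=
  (((forall n w, is_lin (fun u => YW u n w)) /\ (forall u n, is_lin (YW u n))) /\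
     (
      (forall u w, exists N : int, forall n, N <= n -> YW u n w = 0)) /\
     (
      (forall n w, YW one n w = if n == -1 then w else 0)) /\
     (jacobi YV YW) /\
     (
      (forall j, is_lin (LW j)) /\
      (forall (m n : int) w, -1 <= m <= 1 -> -1 <= n <= 1 ->
         LW m (LW n w) - LW n (LW m w) = (m - n)%:~R *: LW (m + n) w)) /\
     ((* [L(j), Y(v,x)] = sum_{k=0}^{j+1} binom(j+1,k) x^{j+1-k} Y(L(k-1)v,x) *)
      (forall (j : int) v n w, -1 <= j <= 1 ->
         LW j (YW v n w) - YW v n (LW j w) =
         \sum_(k < (absz (j + 1)).+1)
            ('C(absz (j + 1), k))%:R *: YW (LV (k%:Z - 1) v) (n + j + 1 - k%:Z) w)) /\
     ((* L(-1)-derivative property  d/dx Y(v,x) = Y(L(-1)v,x) *)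
      (forall v n w, YW (LV (-1) v) n w = - (n%:~R) *: YW v (n - 1) w))).

Definition mobius_va (C : fieldType) (V : lmodType C)
  (Y : V -> int -> V -> V) (one : V) (L : int -> V -> V) (piV : int -> V -> V) :=
  [/\ mobius_action Y one L Y L,
      (forall v n, 0 <= n -> Y v n one = 0) /\ (forall v, Y v (-1) one = v),
      decomposition piV &
      (forall n v, L 0 (piV n v) = n%:~R *: piV n v)].

Definition strongly_graded_mobius_va (C : fieldType) (A : zmodType)
  (V : lmodType C) (Y : V -> int -> V -> V) (one : V) (L : int -> V -> V)
  (piV : int -> V -> V) (piA : A -> V -> V) :=
  ((mobius_va Y one L piV) /\
     (decomposition piA) /\
     ((forall n a v, piV n (piA a v) = piA a (piV n v))) /\
     (piA 0 one = one) /\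
     ((forall a b u w l, piA a u = u -> piA b w = w ->
          piA (a + b) (Y u l w) = Y u l w)) /\
     ((forall (j : int) a v, -1 <= j <= 1 -> piA a v = v -> piA a (L j v) = L j v)) /\
     ((forall n a, findim [set v | piV n v = v /\ piA a v = v])) /\
     ((forall n a, exists K : int, forall k, k <= K ->
          forall v, piV (n + k) v = v -> piA a v = v -> v = 0))).

Definition gen_module (C : fieldType) (V W : lmodType C)
  (Y : V -> int -> V -> V) (one : V) (L : int -> V -> V)
  (YW : V -> int -> W -> W) (LW : int -> W -> W) (piW : C -> W -> W) :=
  [/\ mobius_action Y one L YW LW,
      decomposition piW &
      (forall (n : C) w, exists k : nat,
          iter k (fun x => LW 0 x - n *: x) (piW n w) = 0)].

(* strongly Atil-graded generalized module; A is a subgroup of Atil via the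
   injective additive map iota *)
Definition strongly_graded_gen_module (C : fieldType) (A Atil : zmodType)
  (iota : A -> Atil) (V W : lmodType C)
  (Y : V -> int -> V -> V) (one : V) (L : int -> V -> V) (piA : A -> V -> V)
  (YW : V -> int -> W -> W) (LW : int -> W -> W) (piW : C -> W -> W)
  (piAW : Atil -> W -> W) :=
  ((gen_module Y one L YW LW piW) /\
     (decomposition piAW) /\
     ((forall n b w, piW n (piAW b w) = piAW b (piW n w))) /\
     ((forall a b u w l, piA a u = u -> piAW b w = w ->
          piAW (iota a + b) (YW u l w) = YW u l w)) /\
     ((forall (j : int) b w, -1 <= j <= 1 -> piAW b w = w ->
          piAW b (LW j w) = LW j w)) /\
     ((forall n b, findim [set w | piW n w = w /\ piAW b w = w])) /\
     ((forall n b, exists K : int, forall k : int, k <= K ->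
          forall w, piW (n + k%:~R) w = w -> piAW b w = w -> w = 0))).

(* coefficient of x^m in e^{x L(1)} (-x^{-2})^{L(0)} v
     = sum_{j >= 0, h} x^{j - 2h} / j! * (-1)^h L(1)^j v_(h)  *)
Definition opparg (C : fieldType) (V : lmodType C) (L : int -> V -> V)
  (piV : int -> V -> V) (v : V) (m : int) : V :=
  \sum_(jh \in [set jh : nat * int | jh.1%:Z - 2 * jh.2 = m])
     (((-1 : C) ^ jh.2 / (jh.1`!)%:R) *: iter jh.1 (L 1) (piV jh.2 v)).

(* coefficient of x^m in Y^o_W(v,x) w = Y_W(e^{xL(1)}(-x^{-2})^{L(0)}v, x^{-1}) w
   = sum_{m1, p} (opparg v m1)_p w x^{m1} x^{p+1} *)
Definition Yopp (C : fieldType) (V W : lmodType C) (L : int -> V -> V)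
  (piV : int -> V -> V) (YW : V -> int -> W -> W) (v : V) (w : W) (m : int) : W :=
  \sum_(mp \in [set mp : int * int | mp.1 + mp.2 + 1 = m])
     YW (opparg L piV v mp.1) mp.2 w.

(* the series (in x0 = slot 0 and x = slot 1)
     lambda(Y_1(e^{xL(1)}(-x^{-2})^{L(0)}v, x0) w1 (x) w2)
   whose coefficient of x0^q x^m is lambda((opparg v m)_{-q-1} w1 (x) w2) *)
Definition Y1ser (C : fieldType) (V W1 W2 : lmodType C) (L : int -> V -> V)
  (piV : int -> V -> V) (Y1 : V -> int -> W1 -> W1) (lam : W1 -> W2 -> C)
  (v : V) (w1 : W1) (w2 : W2) : ser C := fun e =>
  if e.2 == 0 then lam (Y1 (opparg L piV v e.1.2) (- e.1.1 - 1) w1) w2 else 0.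

(* elements of (W1 (x) W2)^* are represented as bilinear forms W1 -> W2 -> C;
   Yprime ... lam v m w1 w2 == the coefficient of x^m of Y'_{P(z)}(v,x) lam,
   evaluated at w1 (x) w2:
     lam(w1 (x) Y_2^o(v,x) w2)
     + Res_{x0} z^{-1} delta((x^{-1}-x0)/z) lam(Y_1(e^{xL(1)}(-x^{-2})^{L(0)}v,x0)w1 (x) w2) *)
Definition Yprime (C : fieldType) (V W1 W2 : lmodType C) (L : int -> V -> V)
  (piV : int -> V -> V) (Y1 : V -> int -> W1 -> W1) (Y2 : V -> int -> W2 -> W2)
  (z : C) (lam : W1 -> W2 -> C) (v : V) (m : int) : W1 -> W2 -> C :=
  fun w1 w2 =>
    lam w1 (Yopp L piV Y2 v w2 m)
    + smulC (delta_10_z z) (Y1ser L piV Y1 lam v w1 w2) ((-1, m), 0).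

Definition bilinear_form (C : fieldType) (W1 W2 : lmodType C)
  (lam : W1 -> W2 -> C) :=
  (forall (a : C) x y w2, lam (a *: x + y) w2 = a * lam x w2 + lam y w2) /\
  (forall (a : C) w1 x y, lam w1 (a *: x + y) = a * lam w1 x + lam w1 y).

Definition Pz_compatible (C : fieldType) (V W1 W2 : lmodType C)
  (L : int -> V -> V) (piV : int -> V -> V)
  (Y1 : V -> int -> W1 -> W1) (Y2 : V -> int -> W2 -> W2)
  (z : C) (lam : W1 -> W2 -> C) :=
  (forall v, exists N : int, forall m, m < N ->
      forall w1 w2, Yprime L piV Y1 Y2 z lam v m w1 w2 = 0) /\
  (forall v w1 w2 (e : E),
     smulC (delta_1z_0 z)
       (fun e : E => if (e.1.1 == 0) && (e.2 == 0)
           then Yprime L piV Y1 Y2 z lam v e.1.2 w1 w2 else 0) e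
     = smulC (delta_10_z z) (Y1ser L piV Y1 lam v w1 w2) e
     + smulC (delta_z1_m0 z)
       (fun e : E => if (e.1.1 == 0) && (e.2 == 0)
           then lam w1 (Yopp L piV Y2 v w2 e.1.2) else 0) e).

(* Main.v *)
(** Before the twist [v |-> e^{xL(1)}(-x^{-2})^{L(0)}v], [x |-> x^{-1}], the
    operator [Y'_{P(z)}(v,x)] has modes [lam |-> lam o Delta(v_n)] with
    [Delta(v_n) = 1 (x) v_n + sum_k binom(n,k) z^{n-k} v_k (x) 1] ([coprod]
    below).  Since these act on forms contragrediently, the Jacobi identity to
    be shown for them is the opposite one.  In mode form, the terms of
    [(y1-y2)^l lam o Delta(v)Delta(u)] living on a single factor recombine by
    the Jacobi identities of [W1] and [W2]; for the terms where [v] acts on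
    [W1], writing [y1-y2] as [(y1-z)-x] and using compatibility for the powers
    [(y1-z)^{l-j}] produces precisely the mixed terms of the opposite product,
    so all mixed terms cancel.  The twist is then undone with
    [L1^(j) u_n w = sum_{a+b+c=j} binom(2h-a-n-2,c) (L1^(a)u)_{n+c} L1^(b) w]
    (divided powers of [L(1)], [u] of weight [h]) and a Vandermonde sum. *)
Require Import Defs.
From HB Require Import structures.
From mathcomp Require Import all_boot all_order all_algebra.
From mathcomp Require Import complex zify ring.
From mathcomp Require Import boolp classical_sets fsbigop reals.
Set Implicit Arguments.
Unset Strict Implicit.
Unset Printing Implicit Defensive.
Import Order.TTheory GRing.Theory Num.Theory.
Local Open Scope ring_scope.

(** For [l >= 0] the different expansions of [(y1-y2)^l] agree; the obstacle is [l < 0]. On [W1] one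
    has [y2 = z + x], so the given expansion is in powers of [z + x], whereas the Jacobi identity of
    [W1] calls for powers of [x] alone. Passing from [(y1-(z+x))^l] to [((y1-z)-x)^l] leaves sums
    over all powers of [z]; condition (a) makes them finite and condition (b) evaluates them.
    Compatibility is always that of [lam] itself: in a double action the inner operator is treated
    by compatibility at the pair [(v_k w1, w2)], where [v_k] is the part of the outer operator
    acting on [W1].

    Compatibility is given only for the whole twisted vector [e^{xL(1)}(-x^{-2})^{L(0)}v], while the
    untwisted argument needs it for each mode separately. For homogeneous [v] it is extracted by
    induction on the power of [L(1)] that kills [v]. The weights also enter the conjugation formula,
    so the identity is shown for homogeneous [u], [v] and extended by additivity. *)

(** * Rearranging finite double sums *)

Lemma sum_widen (X : zmodType) (a b : nat) (f : nat -> X) :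
  (a <= b)%N -> (forall i, (a <= i)%N -> f i = 0) ->
  \sum_(i < b) f i = \sum_(i < a) f i.
Proof.
move=> le_ab f0; rewrite (big_ord_widen b f le_ab) [RHS]big_mkcond /=.
by apply: eq_bigr => i _; case: ltnP => // /f0.
Qed.

Lemma sum_triangle (X : zmodType) (K : nat) (F : nat -> nat -> X) :
  \sum_(k < K) \sum_(j < k.+1) F j (k - j)%N =
  \sum_(j < K) \sum_(i < K - j) F j i.
Proof.
elim: K => [|K IH]; first by rewrite !big_ord0.
rewrite big_ord_recr IH big_ord_recr [in RHS]big_ord_recr /= subSnn subnn.
rewrite big_ord1 addrA -big_split /=; congr (_ + _).
by apply: eq_bigr => j _; rewrite subSn 1?ltnW// big_ord_recr.
Qed.

(** Passes between convolutions, where Vandermonde applies, and sums over independent indices, where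
    identities are applied termwise. *)
Lemma sum_square (X : zmodType) (K : nat) (F : nat -> nat -> X) :
  (forall j k, (K <= j + k)%N -> F j k = 0) ->
  \sum_(k < K) \sum_(j < k.+1) F j (k - j)%N = \sum_(j < K) \sum_(k < K) F j k.
Proof.
move=> F0; rewrite sum_triangle; apply: eq_bigr => j _.
rewrite (@sum_widen _ (K - j) K (F j)) ?leq_subr// => i Ki.
by rewrite F0// -leq_subLR.
Qed.

(** * Generalized binomial coefficients *)

Section Binomial.
Variable C : numFieldType.
Local Notation gb := (@gbinom C).

Lemma gbinom0 n : gb n 0 = 1.
Proof. by rewrite /gbinom big_ord0 fact0 divr1. Qed.

Lemma gbinom_rec n k : k.+1%:R * gb n k.+1 = (n%:~R - k%:R) * gb n k.
Proof.
rewrite /gbinom big_ord_recr /= factS natrM.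
have k1 : k.+1%:R != 0 :> C by rewrite pnatr_eq0.
have kf : k`!%:R != 0 :> C by rewrite pnatr_eq0 -lt0n fact_gt0.
by field; rewrite kf nat1r k1.
Qed.

Lemma gbinom_nat (n k : nat) : gb n k = 'C(n, k)%:R.
Proof.
elim: k => [|k IH]; first by rewrite gbinom0 bin0.
have k1 : k.+1%:R != 0 :> C by rewrite pnatr_eq0.
apply: (mulfI k1); rewrite gbinom_rec IH -natrM mul_bin_left natrM.
have [le_kn|lt_nk] := leqP k n; first by rewrite natrB.
by rewrite bin_small// !mulr0.
Qed.

(** The upper indices may be negative, so the proof goes by recursion on [k]: multiply by
    [k+1 = j + (k+1-j)] and absorb each part with [gbinom_rec]. *)
Lemma vandermonde a b k :
  \sum_(j < k.+1) gb a j * gb b (k - j)%N = gb (a + b) k.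
Proof.
elim: k => [|k IH]; first by rewrite big_ord1 !gbinom0 mulr1.
have k1 : k.+1%:R != 0 :> C by rewrite pnatr_eq0.
apply: (mulfI k1); rewrite gbinom_rec -IH !mulr_sumr.
transitivity (\sum_(j < k.+2) (j%:R * gb a j) * gb b (k.+1 - j)%N +
   \sum_(j < k.+2) gb a j * ((k.+1 - j)%:R * gb b (k.+1 - j)%N)).
  rewrite -big_split; apply: eq_bigr => j _ /=.
  by rewrite natrB -1?ltnS//; ring.
rewrite big_ord_recl [X in _ + X]big_ord_recr /= subnn !mul0r mulr0 addr0 add0r.
rewrite -big_split; apply: eq_bigr => j _ /=; rewrite /bump /= add1n gbinom_rec.
have jk : (j <= k)%N by rewrite -ltnS.
by rewrite subSS subSn// gbinom_rec natrB// intrD; ring.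
Qed.

Lemma gbinom_pascal x k : gb (x + 1) k.+1 = gb x k.+1 + gb x k.
Proof.
rewrite [x + 1]addrC -vandermonde !big_ord_recl /= big1 => [|i _].
  rewrite -[bump 0 0]/1%N [gb 1 1](gbinom_nat 1 1) gbinom0 binn.
  by rewrite !mul1r addr0 subSS !subn0.
by rewrite [gb 1 _](gbinom_nat 1) bin_small ?mul0r.
Qed.

Lemma gbinom_trinomial l j i :
  gb l j * gb (l - j%:Z) i = gb l (i + j) * 'C(i + j, j)%:R.
Proof.
elim: i => [|i IH]; first by rewrite gbinom0 add0n binn.
have i1 : i.+1%:R != 0 :> C by rewrite pnatr_eq0.
have ij : (i + j).+1%:R != 0 :> C by rewrite pnatr_eq0.
have E : i.+1%:R * 'C((i + j).+1, j)%:R = (i + j).+1%:R * 'C(i + j, j)%:R :> C.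
  by rewrite -!natrM (mul_bin_down (i + j).+1 j) -addSn addnK.
have G := gbinom_rec l (i + j).
apply: (mulfI i1); rewrite mulrCA gbinom_rec addSn [RHS]mulrCA E.
rewrite [RHS]mulrA [gb l _.+1 * _]mulrC G -[RHS]mulrA -IH intrB natrD; ring.
Qed.

Lemma gbinom_comm l i j :
  gb l j * gb (l - j%:Z) i = gb l i * gb (l - i%:Z) j.
Proof.
by rewrite !gbinom_trinomial [(j + i)%N]addnC -(@bin_sub _ i) ?leq_addr// addKn.
Qed.

Lemma gbinom_upper_neg x k : (-1) ^+ k * gb x k = gb (k%:Z - x - 1) k.
Proof.
rewrite /gbinom mulrA; congr (_ / _).
rewrite [RHS](reindex_inj rev_ord_inj) /= -[X in (-1) ^+ X]card_ord -prodrN.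
apply: eq_bigr => i _; rewrite natrB// -[i.+1]addn1 natrD !intrB; ring.
Qed.

(** Negating the upper index of the second factor turns [x - i] into [r - x - 1], which is free of
    [i]; the ordinary Vandermonde sum then applies. *)
Lemma vandermonde_alternating m x r :
  \sum_(i < r.+1) (-1) ^+ i * gb m i * gb (x - i%:Z) (r - i) = gb (x - m) r.
Proof.
transitivity ((-1) ^+ r * \sum_(i < r.+1) gb m i * gb (r%:Z - x - 1) (r - i)).
  rewrite mulr_sumr; apply: eq_bigr => i _; have ir : (i <= r)%N by rewrite -ltnS.
  have -> : gb (x - i%:Z) (r - i) = (-1) ^+ (r - i) * gb (r%:Z - x - 1) (r - i).
    by rewrite gbinom_upper_neg; congr (gb _ _); lia.
  by rewrite -[in (-1) ^+ r](subnKC ir) exprD; ring.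
rewrite vandermonde gbinom_upper_neg; congr (gb _ _); lia.
Qed.

End Binomial.

(** The sums over [nat] below have finitely many nonzero terms; identities
    between them are stated for all large truncation bounds [B], one bound
    serving all the sums involved. *)
Definition eventually (P : nat -> Prop) :=
  exists K, forall B, (K <= B)%N -> P B.

Lemma eventually_and (P Q : nat -> Prop) :
  eventually P -> eventually Q -> eventually (fun B => P B /\ Q B).
Proof.
move=> [K HP] [K' HQ]; exists (maxn K K') => B; rewrite geq_max => /andP[? ?].
by split; [exact: HP | exact: HQ].
Qed.

Lemma eventually_impl (P Q : nat -> Prop) :
  eventually P -> (forall B, P B -> Q B) -> eventually Q.
Proof. by move=> [K HP] PQ; exists K => B /HP /PQ. Qed.

Lemma eventually_ge (K : nat) : eventually (fun B => (K <= B)%N).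
Proof. by exists K. Qed.

Lemma eventually_all (K : nat) (P : nat -> nat -> Prop) :
  (forall j, eventually (P j)) -> eventually (fun B => forall j, (j < K)%N -> P j B).
Proof.
move=> HP; elim: K => [|K IH]; first by exists 0%N.
apply: eventually_impl (eventually_and IH (HP K)) _ => B [PB PK] j.
by rewrite ltnS leq_eqVlt => /predU1P[->|/PB].
Qed.

(** Vanishing from [B] on allows the same bound on both sides, so that shifts do not disturb the
    common truncation bound. *)
Lemma sum_shift (X : zmodType) (j B : nat) (f : nat -> X) :
  (forall i, (i < j)%N -> f i = 0) -> (forall i, (B <= i)%N -> f i = 0) ->
  \sum_(i < B) f i = \sum_(i < B) f (i + j)%N.
Proof.
move=> f0 fB; rewrite -(@sum_widen _ B (B + j)%N f) ?leq_addr// addnC big_split_ord /=.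
rewrite big1 ?add0r => [|i _]; last exact: f0.
by apply: eq_bigr => i _; rewrite addnC.
Qed.

Lemma fsbig_finite_support (T : choiceType) (X : zmodType) (P : set T)
    (r : seq T) (F : T -> X) :
  uniq r -> (forall i, i \in r -> P i) ->
  (forall i, P i -> i \notin r -> F i = 0) ->
  \sum_(i \in P) F i = \sum_(i <- r) F i.
Proof.
move=> ur rP F0; rewrite (fsbigE r)// big_seq_cond [RHS]big_seq.
by apply: eq_bigl => i; case ir: (i \in r) => //=; exact: mem_set (rP _ ir).
Qed.

Lemma fsbig_nat (X : zmodType) (K : nat) (F : nat -> X) :
  (forall i, (K <= i)%N -> F i = 0) ->
  \sum_(i \in [set: nat]) F i = \sum_(i < K) F i.
Proof.
move=> F0; rewrite (@fsbig_finite_support _ _ _ (iota 0 K)) ?iota_uniq//.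
  by rewrite -(big_mkord xpredT) /index_iota subn0.
by move=> i _; rewrite mem_iota add0n leq0n -leqNgt => /F0.
Qed.

Lemma sum_rotate (X : zmodType) (A B D : nat) (F : 'I_A -> 'I_B -> 'I_D -> X) :
  \sum_(i < A) \sum_(j < B) \sum_(k < D) F i j k =
  \sum_(j < B) \sum_(k < D) \sum_(i < A) F i j k.
Proof.
by rewrite exchange_big; apply: eq_bigr => j _; rewrite exchange_big.
Qed.

(** * Integral powers of -1 and additivity of linear maps *)

Section Signs.
Variable C : numFieldType.
Implicit Types m n : int.

Lemma sign_neq0 : (-1 : C) != 0.
Proof. by rewrite oppr_eq0 oner_eq0. Qed.

Lemma signzD m n : (-1 : C) ^ (m + n) = (-1) ^ m * (-1) ^ n.
Proof. exact: expfzDr sign_neq0. Qed.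

Lemma signzN m : (-1 : C) ^ (- m) = (-1) ^ m.
Proof. by rewrite -exprz_inv invrN invr1. Qed.

Lemma signz_sqr m : (-1 : C) ^ m * (-1) ^ m = 1.
Proof. by rewrite -{2}signzN -signzD subrr expr0z. Qed.

End Signs.

Section Lin.
Variables (C : numFieldType) (X Y : lmodType C) (f : X -> Y) (fl : is_lin f).

Lemma is_linD x y : f (x + y) = f x + f y.
Proof. by rewrite -[x]scale1r fl !scale1r. Qed.
Lemma is_lin0 : f 0 = 0.
Proof. by apply: (addrI (f 0)); rewrite -is_linD !addr0. Qed.
Lemma is_linZ a x : f (a *: x) = a *: f x.
Proof. by rewrite -[a *: x]addr0 fl is_lin0 addr0. Qed.
Lemma is_lin_sum (I : Type) (r : seq I) (P : pred I) (F : I -> X) :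
  f (\sum_(i <- r | P i) F i) = \sum_(i <- r | P i) f (F i).
Proof. by elim/big_rec2: _ => [|i y x _ <-]; rewrite ?is_lin0 ?is_linD. Qed.
End Lin.

(** * The untwisted dual action *)

Section Borcherds.
Variables (C : numFieldType) (V : lmodType C) (Y : V -> int -> V -> V).

Definition truncated (W : lmodType C) (YW : V -> int -> W -> W) :=
  forall u w, exists N : int, forall n, N <= n -> YW u n w = 0.

(** The coefficient of [x0^{-l-1} x1^{-m-1} x2^{-n-1}] in the Jacobi identity. *)
Definition borcherds (W : lmodType C) (YW : V -> int -> W -> W) :=
  forall u v w (l m n : int) B,
  (forall i, (B <= i)%N -> YW v (n + i%:Z) w = 0) ->
  (forall i, (B <= i)%N -> YW u (m + i%:Z) w = 0) ->
  (forall i, (B <= i)%N -> Y u (l + i%:Z) v = 0) ->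
  \sum_(i < B) ((-1) ^+ i * gbinom C l i) *:
     (YW u (m + l - i%:Z) (YW v (n + i%:Z) w)
      - (-1) ^ l *: YW v (n + l - i%:Z) (YW u (m + i%:Z) w))
  = \sum_(i < B) gbinom C m i *: YW (Y u (l + i%:Z) v) (m + n - i%:Z) w.

Lemma truncated_nat (W : lmodType C) (YW : V -> int -> W -> W) u n w :
  truncated YW ->
  eventually (fun B => forall i, (B <= i)%N -> YW u (n + i%:Z) w = 0).
Proof.
by move=> /(_ u w)[N HN]; exists (absz (N - n)) => B hB i hi; apply: HN; lia.
Qed.
End Borcherds.

Section Coproduct.
Variables (C : numFieldType) (V W1 W2 : lmodType C).
Variables (Y : V -> int -> V -> V).
Variables (Y1 : V -> int -> W1 -> W1) (Y2 : V -> int -> W2 -> W2).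
Variables (z : C) (hz : z != 0).
Hypothesis lin1 : forall u n, is_lin (Y1 u n).
Hypothesis lin2 : forall u n, is_lin (Y2 u n).
Hypothesis lin1v : forall n w, is_lin (fun u => Y1 u n w).
Hypothesis tr1 : truncated Y1.
Hypothesis tr2 : truncated Y2.
Hypothesis trV : truncated Y.
Local Notation gb := (@gbinom C).

Definition coprod (lam : W1 -> W2 -> C) (v : V) (n : int) (w1 : W1) (w2 : W2) : C :=
  lam w1 (Y2 v n w2) +
  \sum_(k \in [set: nat]) (gb n k * z ^ (n - k%:Z) * lam (Y1 v k%:Z w1) w2).

(** [P(z)]-compatibility with the twist removed; its condition (b) is taken at
    [x0^{-n-1} y^{-p-1}] with [y = x1^{-1}], and is a tautology for [n >= 0]. *)
Definition coprod_compatible (lam : W1 -> W2 -> C) (v : V) :=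
  (exists N : int, forall (p : int) w1 w2, p <= N -> coprod lam v p w1 w2 = 0) /\
  (forall (n p : int) w1 w2, eventually (fun B =>
    \sum_(i < B) ((-1) ^+ i * gb n i * z ^+ i * coprod lam v (p + n - i%:Z) w1 w2)
    = \sum_(k < B) (gb p k * z ^ (p - k%:Z) * lam (Y1 v (n + k%:Z) w1) w2)
    + \sum_(i < B) ((-1) ^ (n + i%:Z) * gb n i * z ^ (n - i%:Z)
                      * lam w1 (Y2 v (p + i%:Z) w2)))).

Section Bilinear.
Variables (lam : W1 -> W2 -> C) (blam : bilinear_form lam).

Lemma bilinear_formDl x y w : lam (x + y) w = lam x w + lam y w.
Proof. by rewrite -[x]scale1r blam.1 mul1r scale1r. Qed.
Lemma bilinear_formDr x y w : lam w (x + y) = lam w x + lam w y.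
Proof. by rewrite -[x]scale1r blam.2 mul1r scale1r. Qed.
Lemma bilinear_form0l w : lam 0 w = 0.
Proof. by apply: (addrI (lam 0 w)); rewrite -bilinear_formDl !addr0. Qed.
Lemma bilinear_form0r w : lam w 0 = 0.
Proof. by apply: (addrI (lam w 0)); rewrite -bilinear_formDr !addr0. Qed.
Lemma bilinear_formZl a x w : lam (a *: x) w = a * lam x w.
Proof. by rewrite -[a *: x]addr0 blam.1 bilinear_form0l addr0. Qed.
Lemma bilinear_formZr a x w : lam w (a *: x) = a * lam w x.
Proof. by rewrite -[a *: x]addr0 blam.2 bilinear_form0r addr0. Qed.
Lemma bilinear_form_suml (I : Type) (r : seq I) (P : pred I) F w :
  lam (\sum_(i <- r | P i) F i) w = \sum_(i <- r | P i) lam (F i) w.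
Proof. by elim/big_rec2: _ => [|i y x _ <-]; rewrite ?bilinear_form0l ?bilinear_formDl. Qed.
Lemma bilinear_form_sumr (I : Type) (r : seq I) (P : pred I) F w :
  lam w (\sum_(i <- r | P i) F i) = \sum_(i <- r | P i) lam w (F i).
Proof. by elim/big_rec2: _ => [|i y x _ <-]; rewrite ?bilinear_form0r ?bilinear_formDr. Qed.

Lemma coprodE K v n w1 w2 : (forall k : nat, (K <= k)%N -> Y1 v k%:Z w1 = 0) ->
  coprod lam v n w1 w2 = lam w1 (Y2 v n w2) +
  \sum_(k < K) (gb n k * z ^ (n - k%:Z) * lam (Y1 v k%:Z w1) w2).
Proof.
by move=> Y0; rewrite /coprod (@fsbig_nat _ K)// => k /Y0 ->;
   rewrite bilinear_form0l mulr0.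
Qed.

Lemma truncated1_nat v w1 :
  eventually (fun B => forall k : nat, (B <= k)%N -> Y1 v k%:Z w1 = 0).
Proof.
apply: eventually_impl (truncated_nat v 0 w1 tr1) _ => B H k /H.
by rewrite add0r.
Qed.

Lemma coprod_bilinear v n : bilinear_form (coprod lam v n).
Proof.
split=> [a x y w2 | a w1 x y].
  have [K HK] := eventually_and (truncated1_nat v x) (truncated1_nat v y).
  have [Hx Hy] := HK _ (leqnn _).
  rewrite (coprodE _ _ Hx) (coprodE _ _ Hy) (@coprodE K) => [|k Kk]; last first.
    by rewrite (lin1 v k) Hx// Hy// scaler0 addr0.
  rewrite (blam.1 a x y) mulrDr addrACA; congr (_ + _).
  rewrite mulr_sumr -big_split; apply: eq_bigr => k _ /=.
  by rewrite (lin1 v k) blam.1; ring.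
have [K HK] := truncated1_nat v w1; have {}HK := HK _ (leqnn K).
rewrite !(coprodE _ _ HK) (lin2 v n) (blam.2 a w1) mulrDr addrACA.
congr (_ + _); rewrite mulr_sumr -big_split; apply: eq_bigr => k _ /=.
by rewrite blam.2; ring.
Qed.

End Bilinear.

Variables (lam : W1 -> W2 -> C) (blam : bilinear_form lam).
Let T := coprod lam.

(** The coefficient of [x^k] in [(z+x)^N ((y-z)-x)^l] is expanded first, so that
    compatibility of [u] applies to the powers [(y-z)^{l-j}]. *)
Lemma coprod_compatible_half (u v : V) (l M N : int) w1 w2 : coprod_compatible lam u ->
  eventually (fun B =>
  \sum_(i < B) ((-1) ^+ i * gb l i * \sum_(k < B)
     (gb (N + i%:Z) k * z ^ (N + i%:Z - k%:Z) * T u (M + l - i%:Z) (Y1 v k%:Z w1) w2))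
  = \sum_(j < B) \sum_(k < B) \sum_(k' < B)
      ((-1) ^+ j * gb l j * gb N k * gb M k' * z ^ (M + N - k'%:Z - k%:Z)
       * lam (Y1 u (k'%:Z + l - j%:Z) (Y1 v (k%:Z + j%:Z) w1)) w2)
  + \sum_(i < B) ((-1) ^ (l + i%:Z) * gb l i * \sum_(k < B)
     (gb (N + l - i%:Z) k * z ^ (N + l - i%:Z - k%:Z)
      * lam (Y1 v k%:Z w1) (Y2 u (M + i%:Z) w2)))).
Proof.
move=> [[P0 HP0] cu].
have [K HK] := truncated1_nat v w1; have {}HK := HK _ (leqnn K).
have T0w p : T u p 0 w2 = 0 by apply: bilinear_form0l; exact: coprod_bilinear.
(* [Q j k] is compatibility of [u] at exponent [l - j], evaluated at [v_{k+j} w1]. Its truncation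
   bound depends on [j] and [k], but only the finitely many pairs with [k + j < K] matter: beyond
   them the vector is zero. *)
pose Q j k B := \sum_(i < B) ((-1) ^+ i * gb (l - j%:Z) i * z ^+ i
      * T u (M + (l - j%:Z) - i%:Z) (Y1 v (k%:Z + j%:Z) w1) w2)
    = \sum_(k' < B) (gb M k' * z ^ (M - k'%:Z)
        * lam (Y1 u ((l - j%:Z) + k'%:Z) (Y1 v (k%:Z + j%:Z) w1)) w2)
    + \sum_(i < B) ((-1) ^ ((l - j%:Z) + i%:Z) * gb (l - j%:Z) i
        * z ^ ((l - j%:Z) - i%:Z) * lam (Y1 v (k%:Z + j%:Z) w1) (Y2 u (M + i%:Z) w2)).
have HQ : eventually (fun B => forall j, (j < K)%N -> forall k, (k < K)%N -> Q j k B).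
  by apply: eventually_all => j; apply: eventually_all => k; exact: cu.
apply: (eventually_impl (eventually_and HQ (eventually_and (eventually_ge K)
  (eventually_ge (absz (M + l - P0)%R))))) => B [{}HQ [KB PB]].
(* Condition (a) is uniform in the vectors, so one bound truncates [T u] at all the vectors [v_k w1]
   together. *)
have {}HP0 i : (B <= i)%N -> forall w w', T u (M + l - i%:Z) w w' = 0.
  by move=> Bi w w'; apply: HP0; lia.
have HB k : (B <= k)%N -> Y1 v k%:Z w1 = 0 by move=> /(leq_trans KB)/HK.
have {}cu j k : Q j k B.
  have [jkK|Kjk] := ltnP (k + j) K.
    by apply: HQ; lia.
  rewrite /Q -PoszD HK//; rewrite !big1 ?addr0// => i _.
  - by rewrite (bilinear_form0l blam) mulr0.
  - by rewrite (is_lin0 (lin1 _ _)) (bilinear_form0l blam) mulr0.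
  - by rewrite T0w mulr0.
(* Factor [(z+x)^(N+i)] as [(z+x)^i (z+x)^N]: [j] is the power of [x] taken from the first factor,
   [k] the one from the second. *)
pose F j k := \sum_(i < B) ((-1) ^+ i * gb l i * 'C(i, j)%:R * gb N k
   * z ^ (N + i%:Z - (k%:Z + j%:Z)) * T u (M + l - i%:Z) (Y1 v (k%:Z + j%:Z) w1) w2).
transitivity (\sum_(k < B) \sum_(j < k.+1) F j (k - j)%N).
  under eq_bigr do rewrite mulr_sumr.
  rewrite exchange_big /=; apply: eq_bigr => k _.
  rewrite exchange_big /=; apply: eq_bigr => i _.
  rewrite addrC -vandermonde !mulr_suml mulr_sumr; apply: eq_bigr => j _.
  have jk : (j <= k)%N by rewrite -ltnS.
  have -> : (k - j)%N%:Z + j%:Z = k by lia.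
  by rewrite gbinom_nat; ring.
rewrite sum_square => [|j k Bjk]; last first.
  by rewrite /F big1// => i _; rewrite -PoszD HB 1?addnC// T0w mulr0.
have {F}-> : \sum_(j < B) \sum_(k < B) F j k = \sum_(j < B) \sum_(k < B)
    ((-1) ^+ j * gb l j * gb N k * z ^ (N - k%:Z) * \sum_(i < B)
      ((-1) ^+ i * gb (l - j%:Z) i * z ^+ i
      * T u (M + (l - j%:Z) - i%:Z) (Y1 v (k%:Z + j%:Z) w1) w2)).
  apply: eq_bigr => j _; apply: eq_bigr => k _; rewrite /F.
  pose f i := (-1) ^+ i * gb l i * 'C(i, j)%:R * gb N k
   * z ^ (N + i%:Z - (k%:Z + j%:Z)) * T u (M + l - i%:Z) (Y1 v (k%:Z + j%:Z) w1) w2.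
  rewrite -/(f _) (@sum_shift _ j B f) => [|i ij|i Bi]; last 2 first.
  - by rewrite /f bin_small// mulr0 !mul0r.
  - by rewrite /f HP0// mulr0.
  rewrite mulr_sumr; apply: eq_bigr => i _; rewrite /f.
  have -> : M + l - (i + j)%N%:Z = M + (l - j%:Z) - i%:Z by lia.
  have -> : z ^ (N + (i + j)%N%:Z - (k%:Z + j%:Z)) = z ^ (N - k%:Z) * z ^+ i.
    by rewrite exprnP -expfzDr//; congr (_ ^ _); lia.
  rewrite -(mulrA _ (gb l (i + j))) -gbinom_trinomial exprD; ring.
(* The mixed sum is resolved along [(z+x)^(N+l-i) = (z+x)^(l-i) (z+x)^N], to be matched term by term
   with the output of compatibility. *)
have -> : \sum_(i < B) ((-1) ^ (l + i%:Z) * gb l i * \sum_(k < B)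
     (gb (N + l - i%:Z) k * z ^ (N + l - i%:Z - k%:Z)
      * lam (Y1 v k%:Z w1) (Y2 u (M + i%:Z) w2)))
   = \sum_(j < B) \sum_(k < B) \sum_(i < B) ((-1) ^ (l + i%:Z) * gb l i
      * (gb (l - i%:Z) j * gb N k)
      * z ^ (N + l - i%:Z - (k%:Z + j%:Z)) * lam (Y1 v (k%:Z + j%:Z) w1) (Y2 u (M + i%:Z) w2)).
  under [RHS]eq_bigr do rewrite exchange_big.
  rewrite [RHS]exchange_big; apply: eq_bigr => i _ /=.
  rewrite -(@sum_square _ B (fun j k => (-1) ^ (l + i%:Z) * gb l i
      * (gb (l - i%:Z) j * gb N k) * z ^ (N + l - i%:Z - (k%:Z + j%:Z))
      * lam (Y1 v (k%:Z + j%:Z) w1) (Y2 u (M + i%:Z) w2))) => [|j k Bjk]; last first.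
    by rewrite -PoszD HB 1?addnC// (bilinear_form0l blam) mulr0.
  rewrite mulr_sumr; apply: eq_bigr => k _.
  have -> : N + l - i%:Z = (l - i%:Z) + N by lia.
  rewrite -vandermonde !mulr_suml mulr_sumr; apply: eq_bigr => j _.
  have jk : (j <= k)%N by rewrite -ltnS.
  have -> : (k - j)%N%:Z + j%:Z = k by lia.
  by ring.
rewrite -big_split; apply: eq_bigr => j _ /=.
rewrite -big_split; apply: eq_bigr => k _ /=.
rewrite cu mulrDr !mulr_sumr; congr (_ + _); apply: eq_bigr => i _.
  have -> : z ^ (M + N - i%:Z - k%:Z) = z ^ (N - k%:Z) * z ^ (M - i%:Z).
    by rewrite -expfzDr//; congr (_ ^ _); lia.
  have -> : i%:Z + l - j%:Z = l - j%:Z + i%:Z by lia.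
  by ring.
have -> : z ^ (N + l - i%:Z - (k%:Z + j%:Z)) = z ^ (N - k%:Z) * z ^ ((l - j%:Z) - i%:Z).
  by rewrite -expfzDr//; congr (_ ^ _); lia.
have -> : (-1) ^ ((l - j%:Z) + i%:Z) = (-1) ^+ j * (-1) ^ (l + i%:Z) :> C.
  by rewrite !signzD signzN exprnP; ring.
(* The indices [i] and [j] trade places in [binom(l,j) binom(l-j,i)]. Of the two signs [(-1)^j], one
   comes from expanding in [x], the other from compatibility; their product is 1. *)
have G := gbinom_comm C l i j; have S := signz_sqr C j.
rewrite -exprnP in S.
transitivity ((-1) ^+ j * (-1) ^+ j * (gb l j * gb (l - j%:Z) i) * gb N k * z ^ (N - k%:Z)
  * (-1) ^ (l + i%:Z) * z ^ ((l - j%:Z) - i%:Z) * lam (Y1 v (k%:Z + j%:Z) w1) (Y2 u (M + i%:Z) w2)).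
  by ring.
by rewrite S G; ring.
Qed.

Hypothesis bor1 : borcherds Y Y1.
Hypothesis bor2 : borcherds Y Y2.

(** For fixed [k], [k'] the sums over [j] form the left side of the identity of [W1] at
    [(l, k', k)]. On its right side [binom(M,k') binom(k',i) = binom(M,i) binom(M-i,k'-i)], and
    Vandermonde merges [(z+x)^(M-i) (z+x)^N]. *)
Lemma coprod_borcherds_left (u v : V) (l M N : int) w1 w2 :
  eventually (fun B =>
  \sum_(j < B) \sum_(k < B) \sum_(k' < B)
      ((-1) ^+ j * gb l j * gb N k * gb M k' * z ^ (M + N - k'%:Z - k%:Z)
       * lam (Y1 u (k'%:Z + l - j%:Z) (Y1 v (k%:Z + j%:Z) w1)) w2)
  - (-1) ^ l * \sum_(j < B) \sum_(k < B) \sum_(k' < B)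
      ((-1) ^+ j * gb l j * gb M k * gb N k' * z ^ (N + M - k'%:Z - k%:Z)
       * lam (Y1 v (k'%:Z + l - j%:Z) (Y1 u (k%:Z + j%:Z) w1)) w2)
  = \sum_(i < B) gb M i * \sum_(r < B)
     (gb (M + N - i%:Z) r * z ^ (M + N - i%:Z - r%:Z)
       * lam (Y1 (Y u (l + i%:Z) v) r%:Z w1) w2)).
Proof.
have [I HI] := truncated_nat u l v trV; have {}HI := HI _ (leqnn I).
have HR : eventually (fun R => forall i, (i < I)%N -> forall r : nat, (R <= r)%N ->
    Y1 (Y u (l + i%:Z) v) r%:Z w1 = 0).
  by apply: eventually_all => i; exact: truncated1_nat.
have [R {}HR] := HR; have {}HR := HR _ (leqnn R).
(* The mode [k' + k - i] must still reach [R] when [k' >= B] and [i < I], whence [R + I]. *)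
apply: (eventually_impl (eventually_and (eventually_ge (R + I)%N)
  (eventually_and (truncated1_nat u w1) (truncated1_nat v w1)))).
move=> B [IRB [HuB HvB]].
have {}HR i (r : nat) : (R <= r)%N -> Y1 (Y u (l + i%:Z) v) r%:Z w1 = 0.
  have [iI|Ii] := ltnP i I; first exact: HR.
  by rewrite HI// => _; exact: (is_lin0 (lin1v r%:Z w1)).
have HB i : (B <= i)%N -> Y u (l + i%:Z) v = 0 by move=> Bi; apply: HI; lia.
transitivity (\sum_(k < B) \sum_(k' < B) gb N k * gb M k' * z ^ (M + N - k'%:Z - k%:Z)
   * lam (\sum_(i < B) ((-1) ^+ i * gb l i) *:
     (Y1 u (k'%:Z + l - i%:Z) (Y1 v (k%:Z + i%:Z) w1)
      - (-1) ^ l *: Y1 v (k%:Z + l - i%:Z) (Y1 u (k'%:Z + i%:Z) w1))) w2).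
  rewrite sum_rotate [X in _ - _ * X]sum_rotate [X in _ - _ * X]exchange_big /=.
  rewrite mulr_sumr -sumrB; apply: eq_bigr => k _.
  rewrite mulr_sumr -sumrB; apply: eq_bigr => k' _.
  rewrite (bilinear_form_suml blam) !mulr_sumr -sumrB; apply: eq_bigr => i _.
  rewrite (bilinear_formZl blam) -scaleNr (bilinear_formDl blam) (bilinear_formZl blam).
  by rewrite [N + M]addrC (addrAC _ (- k%:Z)); ring.
have E (k k' : nat) : lam (\sum_(i < B) ((-1) ^+ i * gb l i) *:
     (Y1 u (k'%:Z + l - i%:Z) (Y1 v (k%:Z + i%:Z) w1)
      - (-1) ^ l *: Y1 v (k%:Z + l - i%:Z) (Y1 u (k'%:Z + i%:Z) w1))) w2 =
    \sum_(i < B) lam (gb k'%:Z i *: Y1 (Y u (l + i%:Z) v) (k'%:Z + k%:Z - i%:Z) w1) w2.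
  rewrite bor1 ?(bilinear_form_suml blam)// => i Bi.
    by rewrite -PoszD HvB//; lia.
  by rewrite -PoszD HuB//; lia.
under eq_bigr do under eq_bigr do rewrite E mulr_sumr.
rewrite sum_rotate sum_rotate; apply: eq_bigr => i _ /=.
transitivity (\sum_(a < B) \sum_(k < B) (gb M (a + i) * 'C(a + i, i)%:R * gb N k
   * z ^ (M + N - i%:Z - (a%:Z + k%:Z)) * lam (Y1 (Y u (l + i%:Z) v) (a%:Z + k%:Z) w1) w2)).
  rewrite [RHS]exchange_big; apply: eq_bigr => k _ /=.
  (* The factor [binom(k',i)] vanishes for [k' < i], so [k' = a + i]. *)
  pose f k' := gb N k * gb M k' * z ^ (M + N - k'%:Z - k%:Z) * lam (gb k'%:Z i *:
     Y1 (Y u (l + i%:Z) v) (k'%:Z + k%:Z - i%:Z) w1) w2.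
  rewrite -/(f _) (@sum_shift _ i B f) => [|k' k'i|k' Bk']; last 2 first.
  - by rewrite /f gbinom_nat bin_small// scale0r (bilinear_form0l blam) mulr0.
  - have [iI|Ii] := ltnP i I; last first.
      rewrite /f HI//  (is_lin0 (lin1v _ w1)) scaler0 (bilinear_form0l blam) ?mulr0//.
    rewrite /f; have -> : k'%:Z + k%:Z - i%:Z = (k' + k - i)%N%:Z by lia.
    by rewrite HR ?scaler0 ?(bilinear_form0l blam) ?mulr0//; lia.
  apply: eq_bigr => a _; rewrite /f gbinom_nat (bilinear_formZl blam).
  have -> : (a + i)%N%:Z + k%:Z - i%:Z = a%:Z + k%:Z by lia.
  have -> : M + N - (a + i)%N%:Z - k%:Z = M + N - i%:Z - (a%:Z + k%:Z) by lia.
  by ring.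
rewrite -(@sum_square _ B (fun a k => gb M (a + i) * 'C(a + i, i)%:R * gb N k
   * z ^ (M + N - i%:Z - (a%:Z + k%:Z)) * lam (Y1 (Y u (l + i%:Z) v) (a%:Z + k%:Z) w1) w2))
  => [|a k Bak]; last first.
  by rewrite -PoszD HR ?(bilinear_form0l blam) ?mulr0//; lia.
rewrite mulr_sumr; apply: eq_bigr => r _.
have -> : M + N - i%:Z = (M - i%:Z) + N by lia.
rewrite -vandermonde !mulr_suml mulr_sumr; apply: eq_bigr => a _.
have ar : (a <= r)%N by rewrite -ltnS.
rewrite -gbinom_trinomial; have -> : a%:Z + (r - a)%N%:Z = r by lia.
by ring.
Qed.

(** The factors occur in the order opposite to [borcherds]. *)
Lemma coprod_borcherds (u v : V) (l M N : int) w1 w2 :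
  coprod_compatible lam u -> coprod_compatible lam v ->
  eventually (fun B =>
  \sum_(i < B) ((-1) ^+ i * gb l i *
     (coprod (T u (M + l - i%:Z)) v (N + i%:Z) w1 w2
      - (-1) ^ l * coprod (T v (N + l - i%:Z)) u (M + i%:Z) w1 w2))
  = \sum_(i < B) gb M i * T (Y u (l + i%:Z) v) (M + N - i%:Z) w1 w2).
Proof.
move=> cu cv.
have [I HI] := truncated_nat u l v trV; have {}HI := HI _ (leqnn I).
have HR : eventually (fun R => forall i, (i < I)%N -> forall r : nat, (R <= r)%N ->
    Y1 (Y u (l + i%:Z) v) r%:Z w1 = 0).
  by apply: eventually_all => i; exact: truncated1_nat.
apply: (eventually_impl (eventually_and
  (eventually_and (coprod_compatible_half v l M N w1 w2 cu)
                  (coprod_compatible_half u l N M w1 w2 cv))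
  (eventually_and (coprod_borcherds_left u v l M N w1 w2)
  (eventually_and
  (eventually_and (truncated1_nat u w1) (truncated1_nat v w1))
  (eventually_and
    (eventually_and (truncated_nat u M w2 tr2) (truncated_nat v N w2 tr2))
    (eventually_and (eventually_ge I) HR)))))).
move=> B [[Hu Hv] [Hl [[u1 v1] [[u2 v2] [IB {}HR]]]]].
have HB i : (B <= i)%N -> Y u (l + i%:Z) v = 0 by move=> Bi; apply: HI; lia.
have {}HR i (r : nat) : (B <= r)%N -> Y1 (Y u (l + i%:Z) v) r%:Z w1 = 0.
  have [iI|Ii] := ltnP i I; first exact: HR.
  by rewrite HI// => _; exact: (is_lin0 (lin1v r%:Z w1)).
have blT x p : bilinear_form (T x p) by exact: coprod_bilinear.
(* The outer operator is always split between the factors, the inner one only where the outer acts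
   on [W2]; where it acts on [W1] the inner [T] is kept intact, in the form treated by [Hu] and
   [Hv]. *)
transitivity (\sum_(i < B) (-1) ^+ i * gb l i *
  (lam w1 (Y2 u (M + l - i%:Z) (Y2 v (N + i%:Z) w2)
           - (-1) ^ l *: Y2 v (N + l - i%:Z) (Y2 u (M + i%:Z) w2)))
  + (\sum_(i < B) ((-1) ^+ i * gb l i * \sum_(k < B) (gb (M + l - i%:Z) k
       * z ^ (M + l - i%:Z - k%:Z) * lam (Y1 u k%:Z w1) (Y2 v (N + i%:Z) w2)))
  + \sum_(i < B) ((-1) ^+ i * gb l i * \sum_(k < B)
     (gb (N + i%:Z) k * z ^ (N + i%:Z - k%:Z) * T u (M + l - i%:Z) (Y1 v k%:Z w1) w2)))
  - (-1) ^ l * (\sum_(i < B) ((-1) ^+ i * gb l i * \sum_(k < B) (gb (N + l - i%:Z) k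
       * z ^ (N + l - i%:Z - k%:Z) * lam (Y1 v k%:Z w1) (Y2 u (M + i%:Z) w2)))
  + \sum_(i < B) ((-1) ^+ i * gb l i * \sum_(k < B)
     (gb (M + i%:Z) k * z ^ (M + i%:Z - k%:Z) * T v (N + l - i%:Z) (Y1 u k%:Z w1) w2)))).
  rewrite -!big_split mulr_sumr -sumrB -?big_split; apply: eq_bigr => i _ /=.
  rewrite (coprodE (blT _ _) _ _ v1) (coprodE (blT _ _) _ _ u1).
  rewrite {1}/T (coprodE blam _ _ u1) {2}/T (coprodE blam _ _ v1).
  by rewrite -scaleNr (bilinear_formDr blam) (bilinear_formZr blam); ring.
rewrite Hu Hv.
have S (x y : V) (P Q : int) : \sum_(i < B) (-1) ^ (l + i%:Z) * gb l i *
     (\sum_(k < B) gb (P + l - i%:Z) k * z ^ (P + l - i%:Z - k%:Z) *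
        lam (Y1 x k%:Z w1) (Y2 y (Q + i%:Z) w2)) =
   (-1) ^ l * \sum_(i < B) (-1) ^+ i * gb l i *
     (\sum_(k < B) gb (P + l - i%:Z) k * z ^ (P + l - i%:Z - k%:Z) *
        lam (Y1 x k%:Z w1) (Y2 y (Q + i%:Z) w2)).
  by rewrite mulr_sumr; apply: eq_bigr => i _; rewrite signzD exprnP; ring.
rewrite !S {S}.
have -> : \sum_(i < B) gb M i * T (Y u (l + i%:Z) v) (M + N - i%:Z) w1 w2 =
  lam w1 (\sum_(i < B) gb M i *: Y2 (Y u (l + i%:Z) v) (M + N - i%:Z) w2)
  + \sum_(i < B) gb M i * \sum_(r < B)
     (gb (M + N - i%:Z) r * z ^ (M + N - i%:Z - r%:Z)
       * lam (Y1 (Y u (l + i%:Z) v) r%:Z w1) w2).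
  rewrite (bilinear_form_sumr blam) -big_split; apply: eq_bigr => i _ /=.
  by rewrite /T (coprodE blam _ _ (HR i)) (bilinear_formZr blam) mulrDr.
rewrite -Hl -(bor2 v2 u2 HB) // (bilinear_form_sumr blam).
under [in RHS]eq_bigr do rewrite (bilinear_formZr blam).
set s1 := \sum_(i < B) _; set s2 := \sum_(i < B) _; set s3 := \sum_(j < B) _.
set s4 := \sum_(i < B) _; set s5 := \sum_(j < B) _.
(* One of the two mixed sums cancels formally; the other, [s4], cancels because [(-1)^l] squares to
   1. *)
have G := signz_sqr C l.
transitivity (s3 + (s1 - (-1) ^ l * s2) + s4 - (-1) ^ l * (-1) ^ l * s4).
  by ring.
by rewrite G mul1r addrK.
Qed.

End Coproduct.

(** * Products with delta series *)

Section DeltaProducts.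
Variables (C : numFieldType) (X : lmodType C).
Local Notation gb := (@gbinom C).

(** Injectivity of [g] means that no two terms of the delta series share a monomial, so each
    coefficient is a single [c nk]. In the product the second exponent is then determined by the
    first, leaving one sum over [nk]. *)
Lemma smul_deltaser (P t1 t2 D : term C) (F : ser X) (e : E)
    (g : int * nat -> E) (c : int * nat -> C) (r : seq (int * nat)) :
  (forall nk, eadd (escale (-1) P.2) (eadd (escale (nk.1 - nk.2%:Z) t1.2)
     (eadd (escale nk.2%:Z t2.2) (escale (- nk.1) D.2))) = g nk) ->
  (forall nk, P.1 ^ (-1) * gb nk.1 nk.2 * t1.1 ^ (nk.1 - nk.2%:Z)
       * t2.1 ^+ nk.2 * D.1 ^ (- nk.1) = c nk) ->
  injective g -> uniq r ->
  (forall nk, nk \notin r -> F (eadd e (escale (-1) (g nk))) = 0) ->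
  smul (deltaser P t1 t2 D) F e =
  \sum_(nk <- r) c nk *: F (eadd e (escale (-1) (g nk))).
Proof.
move=> Eg Ec ginj ur F0.
have eK (x y : E) : eadd x (eadd y (escale (-1) x)) = y.
  by case: x y => [[? ?] ?] [[? ?] ?]; rewrite /eadd /escale /=; congr (_, _, _); ring.
have deltaE nk : deltaser P t1 t2 D (g nk) = c nk.
  rewrite /deltaser (@fsbig_finite_support _ _ _ [:: nk])//.
  - by rewrite big_seq1 Ec.
  - by move=> i; rewrite inE => /eqP -> /=; rewrite Eg.
  - by move=> i /=; rewrite Eg => /ginj ->; rewrite inE eqxx.
rewrite /smul (@fsbig_finite_support _ _ _
  [seq (g nk, eadd e (escale (-1) (g nk))) | nk <- r]).
- by rewrite big_map; apply: eq_bigr => nk _; rewrite /= deltaE.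
- by rewrite map_inj_uniq// => x y [/ginj].
- by move=> p /mapP[nk _ ->] /=; rewrite eK.
move=> [x y] /= xy pr.
have [[nk gnk]|gx] := pselect (exists nk, g nk = x).
  have yE : y = eadd e (escale (-1) (g nk)).
    rewrite -xy gnk; move: (x) (y) => [[? ?] ?] [[? ?] ?].
    by rewrite /eadd /escale /=; congr (_, _, _); ring.
  rewrite yE F0 ?scaler0//; apply: contra pr => nkr.
  by apply/mapP; exists nk; rewrite // -yE gnk.
rewrite [deltaser _ _ _ _ _](@fsbig_finite_support _ _ _ [::])//.
  by rewrite big_nil scale0r.
by move=> nk /= nkx; case: gx; exists nk; rewrite -Eg.
Qed.

(** When [F] does not involve one of the variables, matching the exponent of that variable fixes [n]
    as a function [phi] of [k]. *)
Lemma smul_deltaser_line (P t1 t2 D : term C) (F : ser X) (e : E)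
    (g h : int * nat -> E) (c : int * nat -> C) (phi : nat -> int) (K : nat) :
  (forall nk, eadd (escale (-1) P.2) (eadd (escale (nk.1 - nk.2%:Z) t1.2)
     (eadd (escale nk.2%:Z t2.2) (escale (- nk.1) D.2))) = g nk) ->
  (forall nk, P.1 ^ (-1) * gb nk.1 nk.2 * t1.1 ^ (nk.1 - nk.2%:Z)
       * t2.1 ^+ nk.2 * D.1 ^ (- nk.1) = c nk) ->
  injective g ->
  (forall nk, eadd e (escale (-1) (g nk)) = h nk) ->
  (forall n k, n != phi k -> F (h (n, k)) = 0) ->
  (forall k, (K <= k)%N -> F (h (phi k, k)) = 0) ->
  smul (deltaser P t1 t2 D) F e =
  \sum_(k < K) c (phi k, nat_of_ord k) *: F (h (phi k, nat_of_ord k)).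
Proof.
move=> Eg Ec ginj Eh F0 FK.
rewrite (@smul_deltaser _ _ _ _ _ _ g c [seq (phi k, k) | k <- iota 0 K])//.
- have -> : iota 0 K = index_iota 0 K by rewrite /index_iota subn0.
  by rewrite big_map big_mkord; apply: eq_bigr => k _; rewrite Eh.
- by rewrite map_inj_uniq ?iota_uniq// => x y [].
move=> [n k] nk; rewrite Eh; have [nE|/F0//] := eqVneq n (phi k).
rewrite nE FK// leqNgt; apply: contra nk => kK; rewrite nE.
by apply/mapP; exists k; rewrite // mem_iota add0n leq0n.
Qed.

Lemma smul_delta_12_0 (F : ser X) (l b c : int) (K : nat) :
  (forall e, e.1.1 != 0 -> F e = 0) ->
  (forall k : nat, (K <= k)%N -> F ((0, b - l + k%:Z), c - k%:Z) = 0) ->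
  smul (delta_12_0 C) F ((-1 - l, b), c) =
  \sum_(k < K) ((-1) ^+ k * gb l k) *: F ((0, b - l + k%:Z), c - k%:Z).
Proof.
move=> F0 FK.
have EE (k : nat) : ((l - l, b - l + k%:Z), c - k%:Z) = ((0, b - l + k%:Z), c - k%:Z).
  by rewrite subrr.
rewrite /delta_12_0 (@smul_deltaser_line _ _ _ _ _ _
  (fun nk => ((-1 - nk.1, nk.1 - nk.2%:Z), nk.2%:Z))
  (fun nk => ((nk.1 - l, b - nk.1 + nk.2%:Z), c - nk.2%:Z))
  (fun nk => (-1) ^+ nk.2 * gb nk.1 nk.2) (fun _ => l) K).
- by apply: eq_bigr => k _; rewrite EE.
- by move=> nk; rewrite /eadd /escale /=; congr (_, _, _); ring.
- by move=> nk; rewrite !exp1rz; ring.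
- by move=> [n k] [n' k'] /= [] ? ? ?; congr (_, _); lia.
- by move=> nk; rewrite /eadd /escale /=; congr (_, _, _); ring.
- by move=> n k nl; apply: F0; rewrite /= subr_eq0.
by move=> k Kk; rewrite EE FK.
Qed.

Lemma smul_delta_21_m0 (F : ser X) (l b c : int) (K : nat) :
  (forall e, e.1.1 != 0 -> F e = 0) ->
  (forall k : nat, (K <= k)%N -> F ((0, b - k%:Z), c - l + k%:Z) = 0) ->
  smul (delta_21_m0 C) F ((-1 - l, b), c) =
  (-1) ^ l *: \sum_(k < K) ((-1) ^+ k * gb l k) *: F ((0, b - k%:Z), c - l + k%:Z).
Proof.
move=> F0 FK.
have EE (k : nat) : ((l - l, b - k%:Z), c - l + k%:Z) = ((0, b - k%:Z), c - l + k%:Z).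
  by rewrite subrr.
rewrite /delta_21_m0 (@smul_deltaser_line _ _ _ _ _ _
  (fun nk => ((-1 - nk.1, nk.2%:Z), nk.1 - nk.2%:Z))
  (fun nk => ((nk.1 - l, b - nk.2%:Z), c - nk.1 + nk.2%:Z))
  (fun nk => (-1) ^ nk.1 * ((-1) ^+ nk.2 * gb nk.1 nk.2)) (fun _ => l) K).
- by rewrite scaler_sumr; apply: eq_bigr => k _; rewrite EE scalerA.
- by move=> nk; rewrite /eadd /escale /=; congr (_, _, _); ring.
- by move=> nk; rewrite !exp1rz signzN; ring.
- by move=> [n k] [n' k'] /= [] ? ? ?; congr (_, _); lia.
- by move=> nk; rewrite /eadd /escale /=; congr (_, _, _); ring.
- by move=> n k nl; apply: F0; rewrite /= subr_eq0.
by move=> k Kk; rewrite EE FK.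
Qed.

(** Slot 1 forces [n = k - m - 1], and [(-1)^k binom(k-m-1,k) = binom(m,k)] by negating the upper
    index. *)
Lemma smul_delta_10_2 (F : ser X) (a m c : int) (K : nat) :
  (forall e, e.1.2 != 0 -> F e = 0) ->
  (forall k : nat, (K <= k)%N -> F ((a - k%:Z, 0), c - m + k%:Z) = 0) ->
  smul (delta_10_2 C) F ((a, - m - 1), c) =
  \sum_(k < K) gb m k *: F ((a - k%:Z, 0), c - m + k%:Z).
Proof.
move=> F0 FK.
have EE (k : nat) : ((a - k%:Z, k%:Z - m - 1 - (k%:Z - m - 1)), c + 1 + (k%:Z - m - 1)) =
   ((a - k%:Z, 0), c - m + k%:Z) by congr (_, _, _); ring.
rewrite /delta_10_2 (@smul_deltaser_line _ _ _ _ _ _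
  (fun nk => ((nk.2%:Z, nk.1 - nk.2%:Z), -1 - nk.1))
  (fun nk => ((a - nk.2%:Z, nk.2%:Z - m - 1 - nk.1), c + 1 + nk.1))
  (fun nk => (-1) ^+ nk.2 * gb nk.1 nk.2) (fun k => k%:Z - m - 1) K).
- apply: eq_bigr => k _; rewrite EE gbinom_upper_neg; congr (gb _ _ *: _).
  by rewrite /=; ring.
- by move=> nk; rewrite /eadd /escale /=; congr (_, _, _); ring.
- by move=> nk; rewrite !exp1rz; ring.
- by move=> [n k] [n' k'] /= [] ? ? ?; congr (_, _); lia.
- by move=> nk; rewrite /eadd /escale /=; congr (_, _, _); ring.
- by move=> n k nl; apply: F0; rewrite /= subr_eq0 eq_sym.
by move=> k Kk; rewrite EE FK.
Qed.
End DeltaProducts.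

Lemma jacobi_borcherds (C : numFieldType) (V W : lmodType C)
    (Y : V -> int -> V -> V) (YW : V -> int -> W -> W) :
  (forall n w, is_lin (fun u => YW u n w)) ->
  (forall u n, is_lin (YW u n)) -> jacobi Y YW -> borcherds Y YW.
Proof.
move=> linv lin J u v w l m n B Bv Bu BY.
have := J u v w ((-1 - l, - m - 1), - n - 1).
rewrite (@smul_delta_12_0 _ _ _ _ _ _ B) => [|e /negPf -> //|k Bk]; last first.
  rewrite /=; have -> : - (- n - 1 - k%:Z) - 1 = n + k%:Z by ring.
  by rewrite Bv// (is_lin0 (lin _ _)).
rewrite (@smul_delta_21_m0 _ _ _ _ _ _ B) => [|e /negPf -> //|k Bk]; last first.
  rewrite /=; have -> : - (- m - 1 - k%:Z) - 1 = m + k%:Z by ring.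
  by rewrite Bu// (is_lin0 (lin _ _)).
rewrite (@smul_delta_10_2 _ _ _ _ _ _ B) => [|e /negPf -> //|k Bk]; last first.
  rewrite /=; have -> : - (-1 - l - k%:Z) - 1 = l + k%:Z by ring.
  by rewrite BY// (is_lin0 (linv _ _)).
move=> /= E0; apply: etrans (etrans E0 _).
  rewrite scaler_sumr -sumrB; apply: eq_bigr => i _.
  have -> : - (- m - 1 - l + i%:Z) - 1 = m + l - i%:Z by ring.
  have -> : - (- n - 1 - i%:Z) - 1 = n + i%:Z by ring.
  have -> : - (- n - 1 - l + i%:Z) - 1 = n + l - i%:Z by ring.
  have -> : - (- m - 1 - i%:Z) - 1 = m + i%:Z by ring.
  by rewrite scalerBr !scalerA [(-1) ^ l * _]mulrC.
by apply: eq_bigr => i _; congr (_ *: YW (Y _ _ _) _ _); ring.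
Qed.

Lemma eventually_seq (T : eqType) (s : seq T) (P : T -> nat -> Prop) :
  (forall x, x \in s -> eventually (P x)) ->
  eventually (fun B => forall x, x \in s -> P x B).
Proof.
elim: s => [|x s IH] HP; first by exists 0%N.
have {}IH : eventually (fun B => forall x, x \in s -> P x B).
  by apply: IH => y ys; apply: HP; rewrite inE ys orbT.
apply: eventually_impl (eventually_and IH (HP x (mem_head _ _))) _ => B [Ps Px] y.
by rewrite inE => /predU1P[->|/Ps].
Qed.

(** [opparg] is indexed by degrees, each counted once, while an expansion may list a degree
    repeatedly; this sum reconciles the two. *)
Lemma sum_by_degree (T : eqType) (X : seq (int * T)) (Z : zmodType) (F : int * T -> Z) :
  \sum_(d <- undup (map fst X)) \sum_(p <- X | p.1 == d) F p = \sum_(p <- X) F p.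
Proof.
rewrite (exchange_big_dep xpredT)//= big_seq [RHS]big_seq; apply: eq_bigr => p pX.
rewrite -big_filter.
have -> : [seq i <- undup (map fst X) | p.1 == i] = [:: p.1].
  rewrite -(@filter_pred1_uniq _ (undup (map fst X)) p.1) ?undup_uniq//.
    by apply: eq_filter => i /=; rewrite eq_sym.
  by rewrite mem_undup map_f.
by rewrite big_seq1.
Qed.

(** * The twist *)

Section Expansion.
Variables (C : numFieldType) (V : lmodType C).
Variables (L : int -> V -> V) (piV : int -> V -> V).
Local Notation gb := (@gbinom C).

(** [X] lists the monomials [x^d w] (as pairs [(d, w)], repetitions allowed) of
    the Laurent polynomial [e^{xL(1)}(-x^{-2})^{L(0)}v]. *)
Definition opp_expansion (v : V) (X : seq (int * V)) :=
  forall m, opparg L piV v m = \sum_(p <- X | p.1 == m) p.2.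

Lemma opparg_notin v X m :
  opp_expansion v X -> m \notin undup (map fst X) -> opparg L piV v m = 0.
Proof.
move=> vX mX; rewrite vX big_seq_cond big1// => p /andP[pX /eqP pm].
by move: mX; rewrite mem_undup -pm map_f.
Qed.

Lemma Yopp_expansion (W : lmodType C) (YW : V -> int -> W -> W) v X w m :
  (forall n w, is_lin (fun u => YW u n w)) -> opp_expansion v X ->
  Yopp L piV YW v w m = \sum_(p <- X) YW p.2 (m - 1 - p.1) w.
Proof.
move=> lin vX; rewrite -sum_by_degree /Yopp (@fsbig_finite_support _ _ _
  [seq (d, m - 1 - d) | d <- undup (map fst X)]).
- rewrite big_map; apply: eq_bigr => d _ /=; rewrite vX.
  rewrite (is_lin_sum (lin (m - 1 - d) w)).
  by apply: eq_bigr => p /eqP ->.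
- by rewrite map_inj_uniq ?undup_uniq// => x y [].
- by move=> p /mapP[d _ ->] /=; ring.
move=> [d q] /= dq dqX; rewrite (opparg_notin vX) ?(is_lin0 (lin _ _))//.
apply: contra dqX => dX; apply/mapP; exists d => //; congr (_, _); lia.
Qed.

(** * The dual action and compatibility in terms of the coproduct *)

Section Dual.
Variables (W1 W2 : lmodType C).
Variables (Y1 : V -> int -> W1 -> W1) (Y2 : V -> int -> W2 -> W2).
Variables (z : C) (hz : z != 0).
Hypothesis lin1v : forall n w, is_lin (fun u => Y1 u n w).
Hypothesis lin2v : forall n w, is_lin (fun u => Y2 u n w).
Hypothesis tr1 : truncated Y1.
Hypothesis tr2 : truncated Y2.
Local Notation Yp := (Yprime L piV Y1 Y2 z).
Local Notation coprod := (coprod Y1 Y2 z).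

(** Here both exponents of the second factor vary: at degree [d] of the twisted vector one gets
    [n = d - b + k]. Negating the upper index turns [(-1)^k binom(n,k) z^(-1-n)] into the
    coefficient of [x^k] in [(z+x)^(b-1-d)]. The exponent [q] is left free to serve both the residue
    and condition (b). *)
Lemma smul_delta_10_z (lam : W1 -> W2 -> C) v X w1 w2 (q b : int) K :
  bilinear_form lam -> opp_expansion v X ->
  (forall p, p \in X -> forall k : nat, (K <= k)%N -> Y1 p.2 (k%:Z - q - 1) w1 = 0) ->
  smulC (delta_10_z z) (Y1ser L piV Y1 lam v w1 w2) ((q, b), 0) =
  \sum_(p <- X) \sum_(k < K) (gb (b - 1 - p.1) k * z ^ (b - 1 - p.1 - k%:Z)
     * lam (Y1 p.2 (k%:Z - q - 1) w1) w2).
Proof.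
move=> blam vX HK.
have YL n d : lam (Y1 (opparg L piV v d) n w1) w2 =
    \sum_(p <- X | p.1 == d) lam (Y1 p.2 n w1) w2.
  by rewrite vX (is_lin_sum (lin1v n w1)) (bilinear_form_suml blam).
have EE d (k : nat) : eadd ((q, b), 0) (escale (-1) ((k%:Z, - ((d - b + k%:Z) - k%:Z)), 0))
    = ((q - k%:Z, d), 0).
  by rewrite /eadd /escale /=; congr (_, _, _); ring.
rewrite /smulC /delta_10_z (@smul_deltaser _ _ _ _ _ _ _ _
  (fun nk => ((nk.2%:Z, - (nk.1 - nk.2%:Z)), 0))
  (fun nk => (-1) ^+ nk.2 * gb nk.1 nk.2 * z ^ (-1 - nk.1))
  [seq (d - b + k%:Z, k) | d <- undup (map fst X), k <- iota 0 K]) //=.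
- rewrite big_allpairs_dep -sum_by_degree; apply: eq_bigr => d _.
  have -> : iota 0 K = index_iota 0 K by rewrite /index_iota subn0.
  rewrite big_mkord [RHS]exchange_big.
  apply: eq_bigr => k _; rewrite EE /Y1ser /= YL.
  have -> : - (q - k%:Z) - 1 = k%:Z - q - 1 by ring.
  rewrite /GRing.scale /= mulr_sumr; apply: eq_bigr => p /eqP ->.
  rewrite gbinom_upper_neg; congr (gb _ _ * z ^ _ * _); ring.
- by move=> nk; rewrite /eadd /escale /=; congr (_, _, _); ring.
- by move=> nk; rewrite exp1rz mulr1 expfzDr//; ring.
- by move=> [n k] [n' k'] /= [] ? ?; congr (_, _); lia.
- apply: allpairs_uniq; rewrite ?undup_uniq ?iota_uniq//.
  by move=> [d k] [d' k'] _ _ /= [] ? ?; congr (_, _); lia.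
move=> [n k] nkX; set e := eadd _ _.
have -> : e = ((q - k%:Z, n + b - k%:Z), 0).
  by rewrite /e /eadd /escale /=; congr (_, _, _); ring.
rewrite /Y1ser /= YL.
have [kK|Kk] := ltnP k K; last first.
  rewrite big_seq_cond big1// => p /andP[pX _].
  have -> : - (q - k%:Z) - 1 = k%:Z - q - 1 by ring.
  by rewrite HK// (bilinear_form0l blam).
rewrite -YL (opparg_notin vX) ?(is_lin0 (lin1v _ _)) ?(bilinear_form0l blam)//.
apply: contra nkX => dX; apply/allpairsP; exists (n + b - k%:Z, k); split=> //=.
  by rewrite mem_iota add0n.
by congr (_, _); ring.
Qed.

Lemma expansion_truncated1 (X : seq (int * V)) w1 (n : int) :
  eventually (fun B => forall p, p \in X ->
    forall k, (B <= k)%N -> Y1 p.2 (n + k%:Z) w1 = 0).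
Proof. by apply: eventually_seq => p _; exact: truncated_nat. Qed.

(** The residue is the case [q = -1], where precisely the modes [k >= 0] of [Y1] occur; hence the
    shape of [coprod]. *)
Lemma Yprime_expansion (lam : W1 -> W2 -> C) v X m w1 w2 :
  bilinear_form lam -> opp_expansion v X ->
  Yp lam v m w1 w2 = \sum_(p <- X) coprod lam p.2 (m - 1 - p.1) w1 w2.
Proof.
move=> blam vX; have [K HK] := expansion_truncated1 X w1 0.
have {}HK := HK _ (leqnn K).
have E (k : int) : k - -1 - 1 = 0 + k by ring.
rewrite /Yprime (@smul_delta_10_z _ _ X _ _ _ _ K)// => [|p pX k Kk]; last first.
  by rewrite E HK.
rewrite (Yopp_expansion w2 m lin2v vX) (bilinear_form_sumr blam) -big_split.
rewrite big_seq [RHS]big_seq; apply: eq_bigr => p pX /=.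
rewrite (@coprodE _ _ _ _ _ _ _ _ blam K) => [|k Kk].
  by congr (_ + _); apply: eq_bigr => k _; rewrite E add0r.
by rewrite -[k%:Z]add0r HK.
Qed.

Lemma smul_delta_1z_0 (F : int -> C) (n b : int) (B : nat) :
  (forall k, (B <= k)%N -> F (b + n - k%:Z) = 0) ->
  smulC (delta_1z_0 z) (fun e : E =>
     if (e.1.1 == 0) && (e.2 == 0) then F e.1.2 else 0) ((-1 - n, b), 0) =
  \sum_(k < B) ((-1) ^+ k * gb n k * z ^+ k * F (b + n - k%:Z)).
Proof.
move=> FB.
rewrite /smulC /delta_1z_0 (@smul_deltaser_line _ _ _ _ _ _ _ _
  (fun nk => ((-1 - nk.1, - (nk.1 - nk.2%:Z)), 0))
  (fun nk => ((nk.1 - n, b + nk.1 - nk.2%:Z), 0))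
  (fun nk => (-1) ^+ nk.2 * gb nk.1 nk.2 * z ^+ nk.2) (fun _ => n) B) /=; first last.
- by move=> k Bk /=; rewrite FB ?if_same.
- by move=> m k mn /=; rewrite subr_eq0 (negPf mn).
- by move=> nk; rewrite /eadd /escale /=; congr (_, _, _); ring.
- by move=> [? k] [? k'] /= [] ? ?; congr (_, _); lia.
- by move=> nk; rewrite !exp1rz (exprNn z); ring.
- by move=> nk; rewrite /eadd /escale /=; congr (_, _, _); ring.
by apply: eq_bigr => k _; rewrite /= subrr.
Qed.

Lemma smul_delta_z1_m0 (F : int -> C) (n b : int) (B : nat) :
  (forall k, (B <= k)%N -> F (b + k%:Z) = 0) ->
  smulC (delta_z1_m0 z) (fun e : E =>
     if (e.1.1 == 0) && (e.2 == 0) then F e.1.2 else 0) ((-1 - n, b), 0) =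
  \sum_(k < B) ((-1) ^ (n + k%:Z) * gb n k * z ^ (n - k%:Z) * F (b + k%:Z)).
Proof.
move=> FB.
rewrite /smulC /delta_z1_m0 (@smul_deltaser_line _ _ _ _ _ _ _ _
  (fun nk => ((-1 - nk.1, - nk.2%:Z), 0))
  (fun nk => ((nk.1 - n, b + nk.2%:Z), 0))
  (fun nk => (-1) ^ (nk.1 + nk.2%:Z) * gb nk.1 nk.2 * z ^ (nk.1 - nk.2%:Z))
   (fun _ => n) B) /=; first last.
- by move=> k Bk /=; rewrite FB ?if_same.
- by move=> m k mn /=; rewrite subr_eq0 (negPf mn).
- by move=> nk; rewrite /eadd /escale /=; congr (_, _, _); ring.
- by move=> [? k] [? k'] /= [] ? ?; congr (_, _); lia.
- by move=> nk; rewrite !exp1rz signzD signzN exprnP; ring.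
- by move=> nk; rewrite /eadd /escale /=; congr (_, _, _); ring.
by apply: eq_bigr => k _; rewrite /= subrr.
Qed.

(** Untwisted and twisted compatibility are related by a triangular system
    (terms with more factors [L 1] are known); this solves it for one unknown. *)
Lemma coprod_compatible_expansion (lam : W1 -> W2 -> C) v d0 x0 X :
  bilinear_form lam -> Pz_compatible L piV Y1 Y2 z lam ->
  opp_expansion v ((d0, x0) :: X) ->
  (forall p, p \in X -> coprod_compatible Y1 Y2 z lam p.2) ->
  coprod_compatible Y1 Y2 z lam x0.
Proof.
move=> blam [ca cb] vX cX; have [N HN] := ca v; split.
  have HX : eventually (fun B => forall p, p \in X -> forall (q : int) w1 w2,
      q <= - B%:Z -> coprod lam p.2 q w1 w2 = 0).
    apply: eventually_seq => p /cX[[M HM] _]; exists (absz M) => B MB q w1 w2 qB.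
    by apply: HM; lia.
  have HD : eventually (fun B => forall p, p \in X -> (absz (d0 - p.1)%R <= B)%N).
    by apply: eventually_seq => p _; exact: eventually_ge.
  have [B HB] := eventually_and HX HD; have {HB HX HD}[HX HD] := HB _ (leqnn B).
  (* Small enough that [p + 1 + d0 < N], so [Yprime] vanishes there, and that each known term has
     mode [p + d0 - d <= - B], so it vanishes too; [B] also bounds the differences [d0 - d]. *)
  exists (N - B%:Z - B%:Z - 2 - d0 - (absz N)%:Z - (absz d0)%:Z) => p w1 w2 pB.
  have := HN (p + 1 + d0); rewrite /= => /(_ _ w1 w2).
  rewrite (Yprime_expansion _ w1 w2 blam vX) big_cons /=.
  have -> : p + 1 + d0 - 1 - d0 = p by ring.
  rewrite big_seq big1 ?addr0 => [|q qX]; first by apply; lia.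
  by case: q qX => [d x] qX; apply: (HX _ qX); move: (HD _ qX) => /=; lia.
(* [b] is the exponent of [x1] at which the unknown vector [x0] occurs with mode exactly [p]. *)
move=> n p w1 w2; pose b := p + 1 + d0; pose X' := (d0, x0) :: X.
have HX : eventually (fun B => forall q, q \in X ->
    \sum_(i < B) ((-1) ^+ i * gb n i * z ^+ i * coprod lam q.2 (b - 1 - q.1 + n - i%:Z) w1 w2)
    = \sum_(k < B) (gb (b - 1 - q.1) k * z ^ (b - 1 - q.1 - k%:Z) * lam (Y1 q.2 (n + k%:Z) w1) w2)
    + \sum_(i < B) ((-1) ^ (n + i%:Z) * gb n i * z ^ (n - i%:Z)
                      * lam w1 (Y2 q.2 (b - 1 - q.1 + i%:Z) w2))).
  by apply: eventually_seq => q /cX[_]; apply.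
have HY2 : eventually (fun B => forall q, q \in X' ->
    forall k, (B <= k)%N -> Y2 q.2 (b - 1 - q.1 + k%:Z) w2 = 0).
  by apply: eventually_seq => q _; exact: truncated_nat.
have := eventually_and HX (eventually_and HY2 (eventually_and
   (expansion_truncated1 X' w1 n) (eventually_ge (absz (b + n - N)%R + 1)%N))).
move=> /eventually_impl; apply => B [{}HX [{}HY2 [HY1 BN]]].
have := cb v w1 w2 ((-1 - n, b), 0).
rewrite (@smul_delta_1z_0 (fun m => Yp lam v m w1 w2) n b B) => [|k Bk]; last first.
  by apply: HN; lia.
rewrite (@smul_delta_10_z _ _ X' _ _ _ _ B)//; last first.
  move=> q qX k Bk; have -> : k%:Z - (-1 - n) - 1 = n + k%:Z by ring.
  exact: HY1.
rewrite (@smul_delta_z1_m0 (fun m => lam w1 (Yopp L piV Y2 v w2 m)) n b B); last first.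
  move=> k Bk; rewrite (Yopp_expansion _ _ lin2v vX) big_seq.
  rewrite big1 ?(bilinear_form0r blam)// => q qX.
  have -> : b + k%:Z - 1 - q.1 = b - 1 - q.1 + k%:Z by ring.
  by rewrite HY2.
pose A q := \sum_(i < B) ((-1) ^+ i * gb n i * z ^+ i
  * coprod lam q.2 (b - 1 - q.1 + n - i%:Z) w1 w2).
pose R1 q := \sum_(k < B) (gb (b - 1 - q.1) k * z ^ (b - 1 - q.1 - k%:Z)
  * lam (Y1 q.2 (n + k%:Z) w1) w2).
pose R2 q := \sum_(i < B) ((-1) ^ (n + i%:Z) * gb n i * z ^ (n - i%:Z)
  * lam w1 (Y2 q.2 (b - 1 - q.1 + i%:Z) w2)).
have -> : \sum_(k < B) (-1) ^+ k * gb n k * z ^+ k * Yp lam v (b + n - k%:Z) w1 w2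
    = \sum_(q <- X') A q.
  rewrite exchange_big; apply: eq_bigr => k _ /=.
  rewrite (Yprime_expansion _ w1 w2 blam vX) mulr_sumr; apply: eq_bigr => q _.
  by congr (_ * coprod _ _ _ _ _); ring.
have -> : \sum_(k < B) (-1) ^ (n + k%:Z) * gb n k * z ^ (n - k%:Z)
      * lam w1 (Yopp L piV Y2 v w2 (b + k%:Z)) = \sum_(q <- X') R2 q.
  rewrite exchange_big; apply: eq_bigr => k _ /=.
  rewrite (Yopp_expansion _ _ lin2v vX) (bilinear_form_sumr blam) mulr_sumr.
  by apply: eq_bigr => q _; congr (_ * lam _ (Y2 _ _ _)); ring.
have -> : \sum_(q <- X') \sum_(k < B) gb (b - 1 - q.1) k * z ^ (b - 1 - q.1 - k%:Z)
      * lam (Y1 q.2 (k%:Z - (-1 - n) - 1) w1) w2 = \sum_(q <- X') R1 q.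
  apply: eq_bigr => q _; apply: eq_bigr => k _.
  by congr (_ * lam (Y1 _ _ _) _); ring.
have EX : \sum_(q <- X) A q = \sum_(q <- X) R1 q + \sum_(q <- X) R2 q.
  by rewrite -big_split big_seq [RHS]big_seq; apply: eq_bigr => q /HX.
rewrite /X' !big_cons EX addrACA => /addIr.
rewrite /A /R1 /R2 /=; have -> : b - 1 - d0 = p by rewrite /b; ring.
by [].
Qed.
End Dual.
End Expansion.

(** * Conjugation of modes by L(1) *)

Section Weights.
Variables (C : numFieldType) (V : lmodType C).
Variables (Y : V -> int -> V -> V) (one : V) (L : int -> V -> V).
Variable (piV : int -> V -> V).
Hypothesis HV : mobius_va Y one L piV.
Local Notation gb := (@gbinom C).

Let act : mobius_action Y one L Y L. Proof. by case: HV. Qed.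
Let dec : decomposition piV. Proof. by case: HV. Qed.

Let linYv n w : is_lin (fun u => Y u n w). Proof. by case: act => [[]]. Qed.
Let linY u n : is_lin (Y u n). Proof. by case: act => [[]]. Qed.
Let linL j : is_lin (L j). Proof. by case: act => _ [_ [_ [_ [[]]]]]. Qed.
Let linpi h : is_lin (piV h). Proof. by case: dec. Qed.

Definition homogeneous (h : int) (v : V) := L 0 v = h%:~R *: v.

Lemma homogeneous_piV h v : homogeneous h (piV h v).
Proof. by case: HV => _ _ _; apply. Qed.

(** Comparing the components of [L 0 v] gives [(h - i) piV i v = 0], and distinct integers stay
    distinct in characteristic 0. *)
Lemma piV_homogeneous h h' v : homogeneous h v -> piV h' v = if h' == h then v else 0.
Proof.
move=> hv; have [_ piK /(_ v)[s [us s0 vs]]] := dec.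
have eig i : piV i (L 0 v) = i%:~R *: piV i v.
  rewrite [in LHS]vs (is_lin_sum (linL 0)) (is_lin_sum (linpi i)).
  have -> : \sum_(j <- s) piV i (L 0 (piV j v)) = \sum_(j <- s | j == i) i%:~R *: piV i v.
    rewrite [RHS]big_mkcond; apply: eq_bigr => j _.
    rewrite homogeneous_piV (is_linZ (linpi i)) piK eq_sym.
    by case: eqP => [->//|_]; rewrite scaler0.
  have [si|/s0 ->] := boolP (i \in s); last by rewrite scaler0 big1.
  by rewrite -big_filter filter_pred1_uniq// big_seq1.
have off i : i != h -> piV i v = 0.
  move=> ih; apply/eqP; have := eig i; rewrite hv (is_linZ (linpi i)) => /eqP.
  rewrite -subr_eq0 -scalerBl scaler_eq0 -intrB intr_eq0 subr_eq0 eq_sym.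
  by rewrite (negPf ih).
have [->|/off//] := eqVneq h' h.
rewrite [RHS]vs; have [sh|hs] := boolP (h \in s).
  by rewrite (bigD1_seq h)//= big1 ?addr0.
by rewrite s0// big_seq big1// => i si; apply: off; apply: contraNneq hs => <-.
Qed.

Lemma L1_homogeneous h v : homogeneous h v -> homogeneous (h - 1) (L 1 v).
Proof.
move=> hv; case: act => _ [_ [_ [_ [[_ sl2] _]]]].
have := sl2 0 1 v erefl erefl; rewrite hv (is_linZ (linL 1)) add0r => /eqP.
rewrite subr_eq => /eqP E; rewrite /homogeneous E -scalerDl; congr (_ *: _).
by rewrite !intrB; ring.
Qed.

Lemma L0_mode u n w :
  L 0 (Y u n w) = Y u n (L 0 w) + Y (L 0 u) n w - (n + 1)%:~R *: Y u n w.
Proof.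
case: act => _ [_ [_ [_ [_ [comm deriv]]]]].
have := comm 0 u n w erefl => /eqP; rewrite subr_eq => /eqP ->.
rewrite big_ord_recl big_ord1 /= binn !scale1r -[L (_ - 1)]/(L (-1)).
rewrite -[L (_ - 1)]/(L 0) deriv.
have -> : n + 0 + 1 - 0 = n + 1 by ring.
have -> : n + 0 + 1 - (bump 0 0)%:Z = n by rewrite /bump /=; ring.
by rewrite addrK scaleNr -addrA addrC [Y (L 0 u) n w + _]addrC.
Qed.

(** In the coefficient, [2h] is the [L(0)] term with its binomial factor 2, and [-(n+2)] comes from
    the [L(-1)]-derivative property. *)
Lemma L1_mode h u n w : homogeneous h u ->
  L 1 (Y u n w) = Y u n (L 1 w) + Y (L 1 u) n w
                  + (2 * h - n - 2)%:~R *: Y u (n + 1) w.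
Proof.
move=> hu; case: act => _ [_ [_ [_ [_ [comm deriv]]]]].
have := comm 1 u n w erefl => /eqP; rewrite subr_eq => /eqP ->.
rewrite 2!big_ord_recl big_ord1 /= binn bin0 bin1 !scale1r.
rewrite -[L (0%N%:Z - 1)]/(L (-1)) -[L ((bump 0 0)%:Z - 1)]/(L 0).
rewrite -[L ((bump 0 (bump 0 0))%:Z - 1)]/(L 1) deriv hu.
have -> : n + 1 + 1 - 0 = n + 1 + 1 by ring.
have -> : n + 1 + 1 - (bump 0 0)%:Z = n + 1 by rewrite /bump /=; ring.
have -> : n + 1 + 1 - (bump 0 (bump 0 0))%:Z = n by rewrite /bump /=; ring.
rewrite ?addrK (is_linZ (linYv _ _)) scalerA addrA -scalerDl addrC.
rewrite [LHS]addrC addrA; congr (_ + _ *: _).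
by rewrite !intrB !intrD intrM; ring.
Qed.

Lemma homogeneous_mode h k u n w : homogeneous h u -> homogeneous k w ->
  homogeneous (h + k - n - 1) (Y u n w).
Proof.
move=> hu hw; rewrite /homogeneous L0_mode hu hw (is_linZ (linY _ _)).
rewrite (is_linZ (linYv _ _)) -!scalerDl -scalerBl; congr (_ *: _).
by rewrite !(intrB, intrD); ring.
Qed.

Definition divided_L1 (j : nat) (v : V) : V := j`!%:R^-1 *: iter j (L 1) v.
Local Notation Ld := divided_L1.

Lemma divided_L10 v : Ld 0 v = v.
Proof. by rewrite /Ld fact0 invr1 scale1r. Qed.

Lemma iter_L1_linear j : is_lin (iter j (L 1)).
Proof. by elim: j => //= j IH a x y; rewrite /= IH linL. Qed.

Lemma divided_L1_linear j : is_lin (Ld j).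
Proof.
by move=> a x y; rewrite /Ld iter_L1_linear scalerDr !scalerA [_^-1 * a]mulrC.
Qed.

Lemma L1_divided_L1 j v : L 1 (Ld j v) = j.+1%:R *: Ld j.+1 v.
Proof.
rewrite /Ld (is_linZ (linL 1)) scalerA factS natrM invfM mulrA divff ?mul1r//.
by rewrite pnatr_eq0.
Qed.

Lemma divided_L1_homogeneous h v j : homogeneous h v -> homogeneous (h - j%:Z) (Ld j v).
Proof.
move=> hv; rewrite /homogeneous /Ld (is_linZ (linL 0)) scalerA mulrC -scalerA.
congr (_ *: _); elim: j => [|j IH] /=; first by rewrite subr0.
have := L1_homogeneous IH; rewrite /homogeneous /= => ->.
by congr (_%:~R *: _); lia.
Qed.

(** The inner sum [D p] is the coefficient of [t^p] in [e^{tL(1)} u_n e^{-tL(1)}]; [L1D] is the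
    corresponding differential equation [[L(1), D p] = (p+1) D (p+1)]. *)
Lemma divided_L1_mode j h u n w : homogeneous h u ->
  Ld j (Y u n w) = \sum_(p < j.+1) \sum_(a < p.+1)
    gb (2 * h - a%:Z - n - 2) (p - a) *: Y (Ld a u) (n + (p - a)%N%:Z) (Ld (j - p) w).
Proof.
move=> hu; pose D p x := \sum_(a < p.+1)
    gb (2 * h - a%:Z - n - 2) (p - a) *: Y (Ld a u) (n + (p - a)%N%:Z) x.
have linD p : is_lin (D p).
  move=> c x y; rewrite /D scaler_sumr -big_split; apply: eq_bigr => a _ /=.
  by rewrite linY scalerDr !scalerA [c * _]mulrC.
have L1D p x : L 1 (D p x) = D p (L 1 x) + p.+1%:R *: D p.+1 x.
  (* [g y c] stands for [binom(y,c-1)], with value 0 at [c = 0], so that Pascal's rule and the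
     recursion hold without a boundary case. *)
  pose g y c := if c is c'.+1 then gb y c' else 0.
  have gP y c : gb (y + 1) c = gb y c + g y c.
    by case: c => [|c]; rewrite ?gbinom0 ?addr0 ?gbinom_pascal.
  have gR (y : int) c : c%:R * gb y c = (y%:~R - c%:R + 1) * g y c.
    case: c => [|c]; first by rewrite mul0r mulr0.
    by rewrite gbinom_rec /= -natr1; congr (_ * _); ring.
  pose y a : V := Y (Ld a u) (n + (p.+1 - a)%N%:Z) x.
  pose X (a : nat) := 2 * h - a%:Z - n - 2.
  (* The first sum collects the terms where [L(1)] hits the divided power of [u], reindexed by one,
     which explains [X a + 1]; the second those where the mode moves up by one. *)
  transitivity (D p (L 1 x) + (\sum_(a < p.+2) (a%:R * gb (X a + 1) (p.+1 - a)) *: y a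
     + \sum_(a < p.+2) ((X a - a%:Z - (p.+1 - a)%N%:Z + 1)%:~R * g (X a) (p.+1 - a)%N) *: y a)).
    rewrite big_ord_recl [X in _ + (_ + X)]big_ord_recr /= subnn mul0r scale0r add0r.
    rewrite mulr0 scale0r addr0 /D (is_lin_sum (linL 1)) -!big_split.
    apply: eq_bigr => a _ /=; have ap : (a <= p)%N by rewrite -ltnS.
    rewrite (is_linZ (linL 1)) (L1_mode _ _ (divided_L1_homogeneous a hu)).
    rewrite L1_divided_L1 (is_linZ (linYv _ _)) /y /bump add1n subSS subSn//=.
    rewrite 2!scalerDr !scalerA -[LHS]addrA; congr (_ + _).
    congr (_ *: _ + _ *: _).
    - by rewrite mulrC; congr (_ * gb _ _); rewrite /X; lia.
    - by rewrite mulrC; congr (_%:~R * _); rewrite /X; lia.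
    by congr (Y _ _ _); lia.
  congr (_ + _); rewrite -big_split scaler_sumr; apply: eq_bigr => a _ /=.
  have ap : (a <= p.+1)%N by rewrite -ltnS.
  rewrite -scalerDl scalerA; congr (_ *: _).
  have -> : p.+1%:R = a%:R + (p.+1 - a)%N%:R :> C by rewrite -natrD subnKC.
  rewrite [RHS]mulrDl gR gP !(intrB, intrD); ring.
elim: j => [|j IH].
  by rewrite !big_ord1 subnn !divided_L10 gbinom0 scale1r addr0.
have j1 : j.+1%:R != 0 :> C by rewrite pnatr_eq0.
apply: (scalerI j1); rewrite -L1_divided_L1 IH (is_lin_sum (linL 1)).
(* The factor [j+1 = (j+1-p) + p] records whether [L(1)] has passed to [w] or raised [D]. *)
transitivity (\sum_(p < j.+2) (j.+1 - p)%N%:R *: D p (Ld (j.+1 - p) w)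
   + \sum_(p < j.+2) p%:R *: D p (Ld (j.+1 - p) w)).
  rewrite [X in _ = X + _]big_ord_recr [X in _ = _ + X]big_ord_recl /= subnn.
  rewrite !scale0r addr0 add0r -big_split; apply: eq_bigr => p _ /=.
  have pj : (p <= j)%N by rewrite -ltnS.
  by rewrite -/(D p _) L1D L1_divided_L1 subSn// (is_linZ (linD p)) /bump add1n subSS.
rewrite -big_split scaler_sumr; apply: eq_bigr => p _ /=.
by rewrite -scalerDl -natrD subnK// -ltnS.
Qed.

End Weights.

(** [L(1)] lowers the weight by one and keeps the [A]-degree, so on a doubly homogeneous vector
    truncation from below stops it; a general vector is a finite sum of such. *)
Lemma strongly_graded_L1_nilpotent (C : numFieldType) (A : zmodType) (V : lmodType C)
    (Y : V -> int -> V -> V) (one : V) (L : int -> V -> V)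
    (piV : int -> V -> V) (piA : A -> V -> V) (v : V) :
  strongly_graded_mobius_va Y one L piV piA ->
  eventually (fun B => forall j, (B <= j)%N -> divided_L1 L j v = 0).
Proof.
move=> [HV [decA [comm [_ [_ [LA [_ trunc]]]]]]].
have linLd j : is_lin (divided_L1 L j) := divided_L1_linear HV j.
pose P (v : V) := eventually (fun B => forall j, (B <= j)%N -> divided_L1 L j v = 0).
have P0 : P 0 by exists 0%N => B _ j _; exact: is_lin0.
have PD x y : P x -> P y -> P (x + y).
  move=> Px Py; apply: eventually_impl (eventually_and Px Py) _ => B [xB yB] j Bj.
  by rewrite (is_linD (linLd j)) xB// yB// addr0.
have [_ _ decV] : decomposition piV by case: HV.
have [_ piAK /(_ _) decA'] := decA.
have [s [_ _ ->]] := decV v; apply: (big_ind P) => // h _.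
have [t [_ _ ->]] := decA' (piV h v); apply: (big_ind P) => // a _.
set x := piA a (piV h v).
have hx : homogeneous L h x by rewrite /x -comm; exact: (homogeneous_piV HV).
have ax : piA a x = x by rewrite /x piAK eqxx.
have [K HK] := trunc h a; exists (absz K) => B KB j Bj.
have -> : divided_L1 L j x = j`!%:R^-1 *: iter j (L 1) x by [].
have jK : - j%:Z <= K by lia.
rewrite (HK _ jK (iter j (L 1) x)) ?scaler0//; last first.
  by elim: j {Bj jK} => [|j IH] //=; exact: LA.
rewrite (piV_homogeneous HV (h := h - j%:Z)) ?eqxx//.
elim: j {Bj jK} => [|j IH] /=; first by rewrite subr0.
by have := L1_homogeneous HV IH; congr (homogeneous L _ _); lia.
Qed.

(** * The Jacobi identity *)

Section Contragredient.
Variables (C : numFieldType) (V W1 W2 : lmodType C).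
Variables (Y : V -> int -> V -> V) (one : V) (L : int -> V -> V).
Variable (piV : int -> V -> V).
Hypothesis HV : mobius_va Y one L piV.
Variables (Y1 : V -> int -> W1 -> W1) (L1 : int -> W1 -> W1).
Variables (Y2 : V -> int -> W2 -> W2) (L2 : int -> W2 -> W2).
Hypothesis HW1 : mobius_action Y one L Y1 L1.
Hypothesis HW2 : mobius_action Y one L Y2 L2.
Variables (z : C) (hz : z != 0).
Local Notation gb := (@gbinom C).
Local Notation Ld := (divided_L1 L).
Local Notation coprod := (coprod Y1 Y2 z).
Local Notation Yp := (Yprime L piV Y1 Y2 z).
Local Notation homogeneous := (homogeneous L).
Hypothesis nilL1 : forall v, eventually (fun B => forall j, (B <= j)%N -> Ld j v = 0).

Let actV : mobius_action Y one L Y L. Proof. by case: HV. Qed.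
Let dec : decomposition piV. Proof. by case: HV. Qed.
Let linYv n w : is_lin (fun u => Y u n w). Proof. by case: actV => [[]]. Qed.
Let linY u n : is_lin (Y u n). Proof. by case: actV => [[]]. Qed.
Let lin1v n w : is_lin (fun u => Y1 u n w). Proof. by case: HW1 => [[]]. Qed.
Let lin1 u n : is_lin (Y1 u n). Proof. by case: HW1 => [[]]. Qed.
Let lin2v n w : is_lin (fun u => Y2 u n w). Proof. by case: HW2 => [[]]. Qed.
Let lin2 u n : is_lin (Y2 u n). Proof. by case: HW2 => [[]]. Qed.
Let trV : truncated Y. Proof. by case: actV => _ []. Qed.
Let tr1 : truncated Y1. Proof. by case: HW1 => _ []. Qed.
Let tr2 : truncated Y2. Proof. by case: HW2 => _ []. Qed.
Let bor1 : borcherds Y Y1.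
Proof. by apply: jacobi_borcherds => //; case: HW1 => _ [_ [_ []]]. Qed.
Let bor2 : borcherds Y Y2.
Proof. by apply: jacobi_borcherds => //; case: HW2 => _ [_ [_ []]]. Qed.
Let linpi h : is_lin (piV h). Proof. by case: dec. Qed.
Let linLd j : is_lin (Ld j). Proof. exact: divided_L1_linear HV j. Qed.

(** * Explicit expansions of the twist *)

Lemma opparg_sum v (s : seq int) (J : nat) m : uniq s ->
  (forall h, h \notin s -> piV h v = 0) ->
  (forall h j, (J <= j)%N -> Ld j (piV h v) = 0) ->
  opparg L piV v m =
  \sum_(h <- s) \sum_(j <- iota 0 J | j%:Z - 2 * h == m) (-1) ^ h *: Ld j (piV h v).
Proof.
move=> us s0 J0; rewrite /opparg (@fsbig_finite_support _ _ _
  [seq x <- [seq (j, h) | h <- s, j <- iota 0 J] | x.1%:Z - 2 * x.2 == m]).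
- rewrite big_filter big_mkcond big_allpairs_dep; apply: eq_bigr => h _.
  by rewrite [RHS]big_mkcond; apply: eq_bigr => j _; rewrite /= /divided_L1 scalerA.
- rewrite filter_uniq// allpairs_uniq ?iota_uniq// => -[j h] [j' h'] _ _ [] -> ->.
  by [].
- by move=> [j h]; rewrite mem_filter => /andP[/eqP].
move=> [j h] /= jh; rewrite mem_filter jh eqxx /= => jhs.
have [hs|/s0 ->] := boolP (h \in s); last first.
  by rewrite (is_lin0 (iter_L1_linear HV j)) scaler0.
have [jJ|Jj] := ltnP j J; last first.
  by rewrite -scalerA -/(divided_L1 L j _) J0 ?scaler0.
by case/negP: jhs; apply/allpairsP; exists (h, j); rewrite /= mem_iota add0n.
Qed.

Lemma nilpotent_components v (s : seq int) :
  (forall h, h \notin s -> piV h v = 0) ->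
  eventually (fun J => forall h j, (J <= j)%N -> Ld j (piV h v) = 0).
Proof.
move=> s0; have := eventually_seq (s := s) (fun h _ => nilL1 (piV h v)).
move=> /eventually_impl; apply => J HJ h j Jj.
have [hs|/s0 ->] := boolP (h \in s); first exact: HJ.
exact: is_lin0.
Qed.

Definition opp_list (s : seq int) (J : nat) (v : V) : seq (int * V) :=
  [seq (j%:Z - 2 * h, (-1) ^ h *: Ld j (piV h v)) | h <- s, j <- iota 0 J].

Lemma opp_list_expansion v (s : seq int) (J : nat) : uniq s ->
  (forall h, h \notin s -> piV h v = 0) ->
  (forall h j, (J <= j)%N -> Ld j (piV h v) = 0) ->
  opp_expansion L piV v (opp_list s J v).
Proof.
move=> us s0 J0 m; rewrite (opparg_sum _ us s0 J0) [RHS]big_mkcond big_allpairs_dep.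
by apply: eq_bigr => h _; rewrite [LHS]big_mkcond.
Qed.

Lemma opp_expansion_exists v : exists X, opp_expansion L piV v X.
Proof.
have [_ _ /(_ v)[s [us s0 _]]] := dec.
have [J HJ] := nilpotent_components s0; exists (opp_list s J v).
by apply: opp_list_expansion => //; exact: HJ.
Qed.

Lemma opparg_add u v m :
  opparg L piV (u + v) m = opparg L piV u m + opparg L piV v m.
Proof.
have [_ _ decV] := dec; have [s [_ s0 _]] := decV u; have [t [_ t0 _]] := decV v.
have st0 h : h \notin undup (s ++ t) -> piV h u = 0 /\ piV h v = 0.
  by rewrite mem_undup mem_cat negb_or => /andP[/s0 -> /t0 ->].
have [J HJ] := eventually_and (nilpotent_components s0) (nilpotent_components t0).
have {HJ}[Ju Jv] := HJ _ (leqnn J).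
rewrite !(@opparg_sum _ (undup (s ++ t)) J) ?undup_uniq//.
- rewrite -big_split; apply: eq_bigr => h _; rewrite -big_split; apply: eq_bigr => j _ /=.
  by rewrite (is_linD (linpi h)) (is_linD (linLd j)) scalerDr.
- by move=> h /st0[].
- by move=> h /st0[].
- by move=> h /st0[hu hv]; rewrite (is_linD (linpi h)) hu hv addr0.
by move=> h j Jj; rewrite (is_linD (linpi h)) (is_linD (linLd j)) Ju// Jv// addr0.
Qed.

Lemma homogeneous_expansion h v J : homogeneous h v ->
  (forall j, (J <= j)%N -> Ld j v = 0) ->
  opp_expansion L piV v [seq (j%:Z - 2 * h, (-1) ^ h *: Ld j v) | j <- iota 0 J].
Proof.
move=> hv J0; have piE := piV_homogeneous HV _ hv.
have := @opp_list_expansion v [:: h] J erefl.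
rewrite /opp_list /= cats0 piE eqxx; apply.
- by move=> h'; rewrite inE piE => /negPf ->.
- move=> h' j Jj; rewrite piE; case: eqP => _; first exact: J0.
  exact: is_lin0.
Qed.

Section Form.
Variables (lam : W1 -> W2 -> C) (blam : bilinear_form lam).

Lemma coprod_linear_mode n w1 w2 :
  @is_lin C V C^o (fun v => coprod lam v n w1 w2).
Proof.
move=> a x y; have [K HK] := eventually_and (truncated1_nat tr1 x w1) (truncated1_nat tr1 y w1).
have {HK}[Kx Ky] := HK _ (leqnn K).
rewrite (coprodE Y2 z blam n w2 Kx) (coprodE Y2 z blam n w2 Ky).
rewrite (@coprodE _ _ _ _ Y1 Y2 z lam blam K) => [|k Kk]; last first.
  by rewrite (lin1v _ w1) Kx// Ky// scaler0 addr0.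
rewrite (lin2v n w2) blam.2 /GRing.scale /= mulrDr addrACA; congr (_ + _).
rewrite mulr_sumr -big_split; apply: eq_bigr => k _ /=.
by rewrite (lin1v _ w1) blam.1; ring.
Qed.

Lemma Yprime_add u v m w1 w2 :
  Yp lam (u + v) m w1 w2 = Yp lam u m w1 w2 + Yp lam v m w1 w2.
Proof.
have [X uX] := opp_expansion_exists u; have [X' vX] := opp_expansion_exists v.
rewrite (Yprime_expansion hz lin1v lin2v tr1 m w1 w2 blam uX).
rewrite (Yprime_expansion hz lin1v lin2v tr1 m w1 w2 blam vX) -big_cat.
apply: (Yprime_expansion hz lin1v lin2v tr1 m w1 w2 blam) => q.
by rewrite opparg_add uX vX big_cat.
Qed.

Lemma Yprime_bilinear v m : bilinear_form (Yp lam v m).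
Proof.
have [X vX] := opp_expansion_exists v.
have E w1 w2 := Yprime_expansion hz lin1v lin2v tr1 m w1 w2 blam vX.
have bil u n : bilinear_form (coprod lam u n) by exact: coprod_bilinear.
split=> *; rewrite !E mulr_sumr -big_split; apply: eq_bigr => q _ /=.
  by rewrite (bil _ _).1.
by rewrite (bil _ _).2.
Qed.

Lemma Yprime_homogeneous h v J n w1 w2 : homogeneous h v ->
  (forall j, (J <= j)%N -> Ld j v = 0) ->
  Yp lam v (- n - 1) w1 w2 =
  (-1) ^ h * \sum_(j < J) coprod lam (Ld j v) (2 * h - 2 - n - j%:Z) w1 w2.
Proof.
move=> hv J0; have vX := homogeneous_expansion hv J0.
rewrite (Yprime_expansion hz lin1v lin2v tr1 _ w1 w2 blam vX) big_map.
have -> : iota 0 J = index_iota 0 J by rewrite /index_iota subn0.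
rewrite big_mkord mulr_sumr; apply: eq_bigr => j _ /=.
rewrite (is_linZ (coprod_linear_mode _ w1 w2)) /GRing.scale /=.
by congr (_ * coprod _ _ _ _ _); ring.
Qed.

(** The twist of [v] has leading term proportional to [v], followed by the divided powers of [L(1)]
    on [v], which are killed by fewer powers of [L(1)] and hence compatible by induction. *)
Lemma homogeneous_compatible h v : Pz_compatible L piV Y1 Y2 z lam ->
  homogeneous h v -> coprod_compatible Y1 Y2 z lam v.
Proof.
move=> clam; have [J HJ] := nilL1 v; have {}HJ : forall j, (J <= j)%N -> iter j (L 1) v = 0.
  move=> j Jj; have /eqP := HJ _ (leqnn J) j Jj; rewrite scaler_eq0 invr_eq0.
  by rewrite pnatr_eq0 -leqn0 leqNgt fact_gt0 /= => /eqP.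
elim: J h v HJ => [|J IH] h v HJ hv.
  have -> : v = 0 by exact: (HJ 0%N).
  have c0 n w1 w2 : coprod lam 0 n w1 w2 = 0 := is_lin0 (coprod_linear_mode n w1 w2).
  split=> [|n p w1 w2]; first by exists 0.
  exists 0%N => B _; rewrite !big1 ?addr0// => i _.
  - by rewrite (is_lin0 (lin2v _ _)) (bilinear_form0r blam) mulr0.
  - by rewrite (is_lin0 (lin1v _ _)) (bilinear_form0l blam) mulr0.
  - by rewrite c0 mulr0.
have Ld_iter j i : iter i (L 1) (Ld j v) = j`!%:R^-1 *: iter (i + j) (L 1) v.
  by rewrite /divided_L1 (is_linZ (iter_L1_linear HV i)) iterD.
(* Used only for its sign: the same vector [v] then heads the expansion without a factor. *)
pose v' := (-1) ^ h *: v.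
have linI j : is_lin (iter j (L 1)) := iter_L1_linear HV j.
have hv' : homogeneous h v'.
  have linL0 : is_lin (L 0) by case: actV => _ [_ [_ [_ [[]]]]].
  by change (L 0 v' = h%:~R *: v'); rewrite /v' (is_linZ linL0) hv !scalerA mulrC.
have Ld' j : (J.+1 <= j)%N -> Ld j v' = 0.
  by move=> Jj; rewrite /v' (is_linZ (linLd j)) /divided_L1 HJ// !scaler0.
have := homogeneous_expansion hv' Ld'; rewrite [iota 0 _]/= map_cons divided_L10.
have -> : (-1) ^ h *: v' = v by rewrite /v' scalerA signz_sqr scale1r.
move=> vX; apply: (coprod_compatible_expansion hz lin1v lin2v tr1 tr2 blam clam vX).
move=> p /mapP[j]; rewrite mem_iota => /andP[j1 _] ->; apply: (IH (h - j%:Z)) => /=.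
  move=> i Ji; rewrite /v' -(is_linZ (linLd j)) scalerA signz_sqr scale1r Ld_iter.
  by rewrite HJ ?scaler0//; lia.
rewrite /v' -(is_linZ (linLd j)) scalerA signz_sqr scale1r.
exact (divided_L1_homogeneous HV j hv).
Qed.

End Form.

Lemma coprod_scaled_sum (J : nat) (F : nat -> W1 -> W2 -> C) (c : C) x r w1 w2 :
  (forall b, bilinear_form (F b)) ->
  coprod (fun w1 w2 => c * \sum_(b < J) F b w1 w2) x r w1 w2 =
  c * \sum_(b < J) coprod (F b) x r w1 w2.
Proof.
move=> bF; have [K HK] := truncated1_nat tr1 x w1; have {}HK := HK _ (leqnn K).
have bs : bilinear_form (fun w1 w2 => c * \sum_(b < J) F b w1 w2).
  split=> a w w' w''; rewrite mulrCA -mulrDr; congr (_ * _);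
    rewrite mulr_sumr -big_split; apply: eq_bigr => b _ /=.
    exact: (bF b).1.
  exact: (bF b).2.
rewrite (coprodE Y2 z bs r w2 HK).
under [in RHS]eq_bigr do rewrite (coprodE Y2 z (bF _) r w2 HK).
rewrite big_split mulrDr exchange_big; congr (_ + _) => /=.
rewrite mulr_sumr; apply: eq_bigr => k _; rewrite mulrCA; congr (_ * _).
by rewrite mulr_sumr.
Qed.

(** Both sides are expanded into untwisted terms. For each pair of divided powers [a], [b] the left
    sides match with the two products interchanged, since [coprod_borcherds] is the opposite
    identity; the right sides match after conjugating by [L(1)] and summing over [i]. *)
Lemma Yprime_borcherds_homogeneous lam h k u v (l m n : int) w1 w2 :
  bilinear_form lam -> Pz_compatible L piV Y1 Y2 z lam ->
  homogeneous h u -> homogeneous k v ->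
  eventually (fun B =>
    \sum_(i < B) ((-1) ^+ i * gb l i *
      (Yp (Yp lam v (- (n + i%:Z) - 1)) u (- (m + l - i%:Z) - 1) w1 w2
       - (-1) ^ l * Yp (Yp lam u (- (m + i%:Z) - 1)) v (- (n + l - i%:Z) - 1) w1 w2))
    = \sum_(i < B) gb m i * Yp lam (Y u (l + i%:Z) v) (- (m + n - i%:Z) - 1) w1 w2).
Proof.
move=> blam clam hu hv.
have [J HJ] := eventually_and (nilL1 u) (nilL1 v); have {HJ}[Ju Jv] := HJ _ (leqnn J).
have HD : eventually (fun D => forall a, (a < J)%N -> forall b, (b < J)%N ->
    forall i, (D <= i)%N -> Y (Ld a u) (l + i%:Z) (Ld b v) = 0).
  by apply: eventually_all => a; apply: eventually_all => b; exact: truncated_nat.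
have [D {}HD] := HD; have {}HD := HD _ (leqnn D).
have {}HD a b c : (J <= a)%N || (J <= b)%N || (D <= c)%N ->
    Y (Ld a u) (l + c%:Z) (Ld b v) = 0.
  have [aJ|Ja] := ltnP a J; last by rewrite Ju// (is_lin0 (linYv _ _)).
  have [bJ|Jb] := ltnP b J; last by rewrite Jv// (is_lin0 (linY _ _)).
  by move=> Dc; apply: HD.
(* The substitution y0 = - x0/(x1 x2), y1 = 1/x1, y2 = 1/x2 carries the index
   (l, m, n) of the identity for Y' to (l, Ma a, Nb b) for the untwisted one. *)
pose Ma (a : nat) : int := 2 * h - 2 - m - l - a%:Z.
pose Nb (b : nat) : int := 2 * k - 2 - n - l - b%:Z.
have HB : eventually (fun B => forall a, (a < J)%N -> forall b, (b < J)%N ->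
  \sum_(i < B) ((-1) ^+ i * gb l i *
     (coprod (coprod lam (Ld a u) (Ma a + l - i%:Z)) (Ld b v) (Nb b + i%:Z) w1 w2
      - (-1) ^ l * coprod (coprod lam (Ld b v) (Nb b + l - i%:Z)) (Ld a u) (Ma a + i%:Z) w1 w2))
  = \sum_(i < B) gb (Ma a) i
      * coprod lam (Y (Ld a u) (l + i%:Z) (Ld b v)) (Ma a + Nb b - i%:Z) w1 w2).
  apply: eventually_all => a; apply: eventually_all => b.
  apply: (coprod_borcherds hz (Y := Y)) => //.
    exact: (homogeneous_compatible blam clam (divided_L1_homogeneous HV a hu)).
  exact: (homogeneous_compatible blam clam (divided_L1_homogeneous HV b hv)).
(* If the orders of the divided powers on [u] and [v] and the mode shift add up to [J + J + D], one
   of them reaches its own bound and the term vanishes. *)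
apply: (eventually_impl (eventually_and HB (eventually_ge (J + J + D)%N))).
move=> B {HB}[HB BJ].
(* The weights contribute [(-1)^h (-1)^k]; interchanging the two products contributes [-(-1)^l]. On
   the right the weight [h + k - l - i - 1] yields the same sign times [(-1)^i]. *)
pose sg : C := - ((-1) ^ h * (-1) ^ k * (-1) ^ l).
transitivity (sg * \sum_(a < J) \sum_(b < J) \sum_(i < B) gb (Ma a) i
      * coprod lam (Y (Ld a u) (l + i%:Z) (Ld b v)) (Ma a + Nb b - i%:Z) w1 w2).
  have bil f q x : bilinear_form f -> bilinear_form (coprod f x q).
    by move=> bf; exact: coprod_bilinear.
  have YY x y p q i j : homogeneous p x -> homogeneous q y ->
     (forall r, (J <= r)%N -> Ld r x = 0) -> (forall r, (J <= r)%N -> Ld r y = 0) ->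
     Yp (Yp lam y (- j - 1)) x (- i - 1) w1 w2 =
     (-1) ^ p * (-1) ^ q * \sum_(a < J) \sum_(b < J)
       coprod (coprod lam (Ld b y) (2 * q - 2 - j - b%:Z)) (Ld a x) (2 * p - 2 - i - a%:Z) w1 w2.
    move=> hx hy Jx Jy.
    rewrite (Yprime_homogeneous (Yprime_bilinear blam _ _) _ _ _ hx Jx) -mulrA.
    congr (_ * _); rewrite mulr_sumr; apply: eq_bigr => a _.
    have -> : Yp lam y (- j - 1) = fun w1 w2 => (-1) ^ q * \sum_(b < J)
        coprod lam (Ld b y) (2 * q - 2 - j - b%:Z) w1 w2.
      by rewrite funeq2E => w w'; exact: Yprime_homogeneous.
    apply: (@coprod_scaled_sum J (fun b => coprod lam (Ld b y) (2 * q - 2 - j - b%:Z))).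
    by move=> b; exact: bil.
  under eq_bigr do rewrite (YY _ _ _ _ _ _ hu hv Ju Jv) (YY _ _ _ _ _ _ hv hu Jv Ju).
  transitivity (\sum_(i < B) \sum_(a < J) \sum_(b < J) sg * ((-1) ^+ i * gb l i *
     (coprod (coprod lam (Ld a u) (Ma a + l - i%:Z)) (Ld b v) (Nb b + i%:Z) w1 w2
      - (-1) ^ l * coprod (coprod lam (Ld b v) (Nb b + l - i%:Z)) (Ld a u) (Ma a + i%:Z) w1 w2))).
    apply: eq_bigr => i _.
    rewrite [X in _ - _ * (_ * X)]exchange_big /= 3!mulr_sumr -sumrB mulr_sumr.
    apply: eq_bigr => a _; rewrite 3!mulr_sumr -sumrB mulr_sumr.
    apply: eq_bigr => b _ /=.
    have -> : 2 * k - 2 - (n + i%:Z) - b%:Z = Nb b + l - i%:Z by rewrite /Nb; ring.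
    have -> : 2 * h - 2 - (m + l - i%:Z) - a%:Z = Ma a + i%:Z by rewrite /Ma; ring.
    have -> : 2 * k - 2 - (n + l - i%:Z) - b%:Z = Nb b + i%:Z by rewrite /Nb; ring.
    have -> : 2 * h - 2 - (m + i%:Z) - a%:Z = Ma a + l - i%:Z by rewrite /Ma; ring.
    set X1 := coprod _ _ _ _ _; set X2 := coprod _ _ _ _ _.
    have G := signz_sqr C l; rewrite /sg.
    transitivity ((-1) ^+ i * gb l i * ((-1) ^ h * (-1) ^ k)
       * ((-1) ^ l * (-1) ^ l * X1 - (-1) ^ l * X2)); last by ring.
    by rewrite G; ring.
  rewrite sum_rotate mulr_sumr; apply: eq_bigr => a _.
  rewrite mulr_sumr; apply: eq_bigr => b _.
  by rewrite -HB// mulr_sumr.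
pose G i a c b := gb m i * (-1) ^+ i * gb (2 * h - a%:Z - (l + i%:Z) - 2) c
   * coprod lam (Y (Ld a u) (l + (i + c)%N%:Z) (Ld b v)) (Ma a + Nb b - (i + c)%N%:Z) w1 w2.
have G0 i a c b : (J <= a)%N || (J <= b)%N || (D <= i + c)%N -> G i a c b = 0.
  by move=> H; rewrite /G HD// (is_lin0 (coprod_linear_mode blam _ _ _)) mulr0.
transitivity (\sum_(i < B) sg * \sum_(a < J) \sum_(b < J) \sum_(c < B) G i a c b); last first.
  apply: eq_bigr => i _.
  have hx := homogeneous_mode HV (l + i%:Z) hu hv.
  have L0 j : (B <= j)%N -> Ld j (Y u (l + i%:Z) v) = 0.
    move=> Bj; rewrite (divided_L1_mode HV _ _ _ hu) big1// => p _; rewrite big1// => a _.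
    have pj := ltn_ord p; have ap := ltn_ord a.
    have -> : l + i%:Z + (p - a)%N%:Z = l + (i + (p - a))%N%:Z by lia.
    by rewrite HD ?scaler0//; lia.
  rewrite (Yprime_homogeneous blam _ _ _ hx L0).
  transitivity (sg * \sum_(j < B) \sum_(p < j.+1) \sum_(a < p.+1) G i a (p - a)%N (j - p)%N).
    rewrite (@sum_square _ B (fun p b => \sum_(a < p.+1) G i a (p - a)%N b)) => [|p b pb].
      congr (_ * _); rewrite [RHS]exchange_big [LHS]exchange_big /=.
      rewrite -(@sum_widen _ J B (fun b => \sum_(a < J) \sum_(c < B) G i a c b)); first last.
      - by move=> b Jb; rewrite big1// => a _; rewrite big1// => c _; rewrite G0// Jb orbT.
      - by lia.
      apply: eq_bigr => b _.
      rewrite (@sum_square _ B (fun a c => G i a c b)) => [|a c ac]; last first.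
        by apply: G0; lia.
      rewrite -(@sum_widen _ J B (fun a => \sum_(c < B) G i a c b))//; first by lia.
      by move=> a Ja; rewrite big1// => c _; rewrite G0// Ja.
    by rewrite big1// => a _; apply: G0; have := ltn_ord a; lia.
  have -> : (-1) ^ (h + k - (l + i%:Z) - 1) = sg * (-1) ^+ i :> C.
    by rewrite !signzD !signzN signzD expr1z exprnP /sg; ring.
  rewrite -[sg * _ * _]mulrA mulrCA; congr (_ * _); rewrite !mulr_sumr.
  apply: eq_bigr => j _; rewrite (divided_L1_mode HV _ _ _ hu).
  rewrite (is_lin_sum (coprod_linear_mode blam _ _ _)) !mulr_sumr; apply: eq_bigr => p _.
  rewrite (is_lin_sum (coprod_linear_mode blam _ _ _)) !mulr_sumr; apply: eq_bigr => a _.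
  have pj := ltn_ord p; have ap := ltn_ord a.
  rewrite (is_linZ (coprod_linear_mode blam _ _ _)) /GRing.scale /= /G.
  have -> : l + i%:Z + (p - a)%N%:Z = l + (i + (p - a))%N%:Z by lia.
  have -> : 2 * (h + k - (l + i%:Z) - 1) - 2 - (m + n - i%:Z) - j%:Z =
    Ma a + Nb (j - p)%N - (i + (p - a))%N%:Z by rewrite /Ma /Nb; lia.
  by rewrite !mulrA.
rewrite -[RHS]mulr_sumr; congr (_ * _); rewrite [RHS]sum_rotate; apply: eq_bigr => a _.
apply: eq_bigr => b _.
rewrite -(@sum_square _ B (fun i c => G i a c b)) => [|i c ic]; last by apply: G0; lia.
apply: eq_bigr => r _.
(* For a fixed total shift [r = i + c], the alternating Vandermonde sum over [i] produces the
   coefficient [binom(Ma a, r)] of the untwisted identity. *)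
have -> : gb (Ma a) r = gb ((2 * h - a%:Z - l - 2) - m) r by congr (gb _ _); rewrite /Ma; ring.
rewrite -vandermonde_alternating mulr_suml; apply: eq_bigr => i _; rewrite /G.
rewrite subnKC -1?ltnS//; congr (_ * gb _ _ * _); first by rewrite mulrC.
by ring.
Qed.

(** * From homogeneous to arbitrary vectors, and back to formal series *)

Lemma Yprime_form_add (f g : W1 -> W2 -> C) v m w1 w2 :
  bilinear_form f -> bilinear_form g ->
  Yp (fun a b => f a b + g a b) v m w1 w2 = Yp f v m w1 w2 + Yp g v m w1 w2.
Proof.
move=> bf bg; have bfg : bilinear_form (fun a b => f a b + g a b).
  by split=> a x y w; rewrite ?bf.1 ?bg.1 ?bf.2 ?bg.2 mulrDr addrACA.
have [X vX] := opp_expansion_exists v.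
rewrite !(Yprime_expansion hz lin1v lin2v tr1 m w1 w2 _ vX)//.
rewrite -big_split; apply: eq_bigr => p _ /=.
have [K HK] := truncated1_nat tr1 p.2 w1; have {}HK := HK _ (leqnn K).
rewrite (coprodE Y2 z bfg _ w2 HK) (coprodE Y2 z bf _ w2 HK) (coprodE Y2 z bg _ w2 HK).
rewrite addrACA; congr (_ + _); rewrite -big_split; apply: eq_bigr => k _ /=.
by rewrite mulrDr.
Qed.

Lemma Yprime_form0 v m w1 w2 : Yp (fun _ _ => 0) v m w1 w2 = 0.
Proof.
have b0 : bilinear_form (fun (_ : W1) (_ : W2) => 0 : C).
  by split=> *; rewrite mulr0 addr0.
have := Yprime_form_add v m w1 w2 b0 b0; rewrite addr0 => /eqP.
by rewrite -subr_eq subrr eq_sym => /eqP.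
Qed.

Section Form.
Variables (lam : W1 -> W2 -> C) (blam : bilinear_form lam).
Hypothesis clam : Pz_compatible L piV Y1 Y2 z lam.

Lemma Yprime0 m w1 w2 : Yp lam 0 m w1 w2 = 0.
Proof.
have := Yprime_add blam 0 0 m w1 w2; rewrite addr0 => /eqP.
by rewrite -subr_eq subrr eq_sym => /eqP.
Qed.

Lemma Yprime_borcherds u v (l m n : int) w1 w2 :
  eventually (fun B =>
    \sum_(i < B) ((-1) ^+ i * gb l i *
      (Yp (Yp lam v (- (n + i%:Z) - 1)) u (- (m + l - i%:Z) - 1) w1 w2
       - (-1) ^ l * Yp (Yp lam u (- (m + i%:Z) - 1)) v (- (n + l - i%:Z) - 1) w1 w2))
    = \sum_(i < B) gb m i * Yp lam (Y u (l + i%:Z) v) (- (m + n - i%:Z) - 1) w1 w2).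
Proof.
pose P u v := eventually (fun B =>
    \sum_(i < B) ((-1) ^+ i * gb l i *
      (Yp (Yp lam v (- (n + i%:Z) - 1)) u (- (m + l - i%:Z) - 1) w1 w2
       - (-1) ^ l * Yp (Yp lam u (- (m + i%:Z) - 1)) v (- (n + l - i%:Z) - 1) w1 w2))
    = \sum_(i < B) gb m i * Yp lam (Y u (l + i%:Z) v) (- (m + n - i%:Z) - 1) w1 w2).
rewrite -/(P u v).
have bY x q : bilinear_form (Yp lam x q) by exact: Yprime_bilinear.
have comp_addl x y u' q r : Yp (Yp lam u' q) (x + y) r w1 w2 =
    Yp (Yp lam u' q) x r w1 w2 + Yp (Yp lam u' q) y r w1 w2.
  exact: (Yprime_add (bY u' q)).
have comp_addr x y u' q r : Yp (Yp lam (x + y) q) u' r w1 w2 =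
    Yp (Yp lam x q) u' r w1 w2 + Yp (Yp lam y q) u' r w1 w2.
  rewrite -Yprime_form_add//; congr (Yp _ _ _ _ _).
  by rewrite funeq2E => a b; exact: Yprime_add.
(* The induction over sums starts at the empty sum; its case is obtained by regarding 0 as
   homogeneous of weight 0. *)
have homo0 : homogeneous 0 0.
  have linL0 : is_lin (L 0) by case: actV => _ [_ [_ [_ [[]]]]].
  by change (L 0 0 = 0%:~R *: 0 :> V); rewrite scaler0 (is_lin0 linL0).
have hom h k x y : homogeneous h x -> homogeneous k y -> P x y.
  exact: Yprime_borcherds_homogeneous.
have [_ _ decV] := dec.
have hpi h x : homogeneous h (piV h x) by exact: (homogeneous_piV HV).
have Pv h x : homogeneous h x -> P x v.
  move=> hx; have [s [_ _ ->]] := decV v; apply: (big_ind (P x)) => [|y y'|k _].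
  - exact: hom hx homo0.
  - move=> Py Py'; apply: eventually_impl (eventually_and Py Py') _ => B [EB EB'].
    under [RHS]eq_bigr do rewrite (is_linD (linY _ _)) (Yprime_add blam) mulrDr.
    rewrite big_split -EB -EB' -big_split; apply: eq_bigr => i _ /=.
    by rewrite comp_addl comp_addr; ring.
  exact: hom hx (hpi _ _).
have [s [_ _ ->]] := decV u; apply: (big_ind (P^~ v)) => [|y y'|k _].
- exact: Pv homo0.
- move=> Py Py'; apply: eventually_impl (eventually_and Py Py') _ => B [EB EB'].
  under [RHS]eq_bigr do rewrite (is_linD (linYv _ _)) (Yprime_add blam) mulrDr.
  rewrite big_split -EB -EB' -big_split; apply: eq_bigr => i _ /=.
  by rewrite comp_addl comp_addr; ring.
exact: Pv (hpi _ _).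
Qed.

Lemma Yprime_jacobi u v w1 w2 (e : E) :
    smulC (delta_12_0 C)
      (fun e : E => if e.1.1 == 0 then Yp (Yp lam v e.2) u e.1.2 w1 w2 else 0) e
  - smulC (delta_21_m0 C)
      (fun e : E => if e.1.1 == 0 then Yp (Yp lam u e.1.2) v e.2 w1 w2 else 0) e
  = smulC (delta_10_2 C)
      (fun e : E => if e.1.2 == 0 then Yp lam (Y u (- e.1.1 - 1) v) e.2 w1 w2 else 0) e.
Proof.
case: e => [[a b] c]; pose l := - a - 1; pose m := - b - 1; pose n := - c - 1.
(* Condition (a) makes the inner form [Yp lam x q] vanish identically for very negative [q], so the
   outer operator annihilates nothing but zero forms there and the two products on the left are
   finite sums. *)
have [N HN] := clam.1 u; have [N' HN'] := clam.1 v.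
have zero x q : (forall w1 w2, Yp lam x q w1 w2 = 0) -> Yp lam x q = fun _ _ => 0.
  by move=> H; rewrite funeq2E.
have [B HB] := eventually_and (Yprime_borcherds u v l m n w1 w2)
  (eventually_and (truncated_nat u l v trV)
  (eventually_and (eventually_ge (absz (b - N)%R + 1)%N)
                  (eventually_ge (absz (c - N')%R + 1)%N))).
have {HB}[HB [Huv [Nb Nc]]] := HB _ (leqnn B).
have -> : ((a, b), c) = ((-1 - l, b), c) :> E by congr (_, _, _); rewrite /l; ring.
rewrite /smulC (@smul_delta_12_0 _ _ _ _ _ _ B) => [|? /negPf -> //|i Bi]; last first.
  by rewrite /= zero ?Yprime_form0// => *; apply: HN'; lia.
rewrite (@smul_delta_21_m0 _ _ _ _ _ _ B) => [|? /negPf -> //|i Bi]; last first.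
  by rewrite /= zero ?Yprime_form0// => *; apply: HN; lia.
have -> : ((-1 - l, b), c) = ((-1 - l, - m - 1), c) :> E.
  by congr (_, _, _); rewrite /m; ring.
rewrite (@smul_delta_10_2 _ _ _ _ _ _ B) => [|? /negPf -> //|i Bi]; last first.
  rewrite /=; have -> : - (-1 - l - i%:Z) - 1 = l + i%:Z by ring.
  by rewrite Huv// Yprime0.
apply: etrans (etrans HB _); rewrite /GRing.scale /=.
  rewrite mulr_sumr -sumrB; apply: eq_bigr => i _.
  have -> : c - i%:Z = - (n + i%:Z) - 1 by rewrite /n; ring.
  have -> : b - l + i%:Z = - (m + l - i%:Z) - 1 by rewrite /m; ring.
  have -> : b - i%:Z = - (m + i%:Z) - 1 by rewrite /m; ring.
  have -> : c - l + i%:Z = - (n + l - i%:Z) - 1 by rewrite /n; ring.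
  by ring.
apply: eq_bigr => i _.
have -> : - (-1 - l - i%:Z) - 1 = l + i%:Z by ring.
by have -> : c - m + i%:Z = - (m + n - i%:Z) - 1 by rewrite /n; ring.
Qed.

End Form.
End Contragredient.

Theorem theorem5p39 (R : realType) (A Atil : zmodType)
  (iota : {additive A -> Atil}) (iota_inj : injective iota)
  (V : lmodType R[i]) (Y : V -> int -> V -> V) (one : V) (L : int -> V -> V)
  (piV : int -> V -> V) (piA : A -> V -> V)
  (HV : strongly_graded_mobius_va Y one L piV piA)
  (W1 : lmodType R[i]) (Y1 : V -> int -> W1 -> W1) (L1 : int -> W1 -> W1)
  (pi1 : R[i] -> W1 -> W1) (piA1 : Atil -> W1 -> W1)
  (HW1 : strongly_graded_gen_module iota Y one L piA Y1 L1 pi1 piA1)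
  (W2 : lmodType R[i]) (Y2 : V -> int -> W2 -> W2) (L2 : int -> W2 -> W2)
  (pi2 : R[i] -> W2 -> W2) (piA2 : Atil -> W2 -> W2)
  (HW2 : strongly_graded_gen_module iota Y one L piA Y2 L2 pi2 piA2)
  (z : R[i]) (hz : z != 0)
  (lam : W1 -> W2 -> R[i]) (hlam : bilinear_form lam)
  (hcomp : Pz_compatible L piV Y1 Y2 z lam)
  (u v : V) :
  forall (w1 : W1) (w2 : W2) (e : E),
    smulC (delta_12_0 R[i])
      (fun e : E => if e.1.1 == 0 then
         Yprime L piV Y1 Y2 z (Yprime L piV Y1 Y2 z lam v e.2) u e.1.2 w1 w2
         else 0) e
  - smulC (delta_21_m0 R[i])
      (fun e : E => if e.1.1 == 0 then
         Yprime L piV Y1 Y2 z (Yprime L piV Y1 Y2 z lam u e.1.2) v e.2 w1 w2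
         else 0) e
  = smulC (delta_10_2 R[i])
      (fun e : E => if e.1.2 == 0 then
         Yprime L piV Y1 Y2 z lam (Y u (- e.1.1 - 1) v) e.2 w1 w2
         else 0) e.
Proof.
move=> w1 w2 e; have [[act1 _ _] _] := HW1; have [[act2 _ _] _] := HW2.
have nil x := strongly_graded_L1_nilpotent x HV.
exact: (Yprime_jacobi HV.1 act1 act2 hz nil hlam hcomp u v w1 w2 e).
Qed.
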